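(* Let $G$ be a residually finite word hyperbolic group in which every proper quasiconvex subgroup is engulfed. Then $G$ is GFERF.
   Context: Let $G$ be a word (Gromov) hyperbolic group with a finite symmetrized generating set $\mathcal{A}$ and Cayley graph $\Gamma(G,\mathcal{A})$. A subset $Q \subseteq G$ is quasiconvex if there exists $\eta \ge 0$ such that for any $u,v \in Q$, every geodesic segment in $\Gamma(G,\mathcal{A})$ connecting $u$ and $v$ lies in the closed $\eta$-neighborhood of $Q$; for hyperbolic groups this does not depend on the choice of the finite generating set. A subgroup $H \le G$ is engulfed if it is contained in a proper finite index subgroup of $G$. The profinite topology on $G$ has as basic open sets the cosets of normal finite index subgroups; a subgroup is closed in it if and only if it is an intersection of finite index subgroups of $G$. A hyperbolic group is GFERF if each of its quasiconvex subgroups is closed in the profinite topology. *)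

(* Defs.v *)
(* Groups are abstract, possibly infinite [groupType]s; their subsets are
   classical sets of MathComp-Analysis. *)
From HB Require Import structures.
From mathcomp Require Import all_boot all_order all_algebra.
From mathcomp Require Import boolp classical_sets functions cardinality topology.

Set Implicit Arguments.
Unset Strict Implicit.
Unset Printing Implicit Defensive.

Import Order.TTheory GRing.Theory Num.Theory.
Local Open Scope classical_set_scope.
Local Open Scope group_scope.

Section Subgroups.
Variable G : groupType.
Implicit Types (g : G) (H N : set G).

Definition subgroup H : Prop := group_closed (mem H).

Definition lcoset g H : set G := [set g * h | h in H].

Definition finite_index H : Prop := finite_set (range (fun g => lcoset g H)).

Definition normal N : Prop := forall g n, N n -> N (n ^ g).

Definition normal_finite_index N : Prop :=
  [/\ subgroup N, normal N & finite_index N].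

Definition generates (A : set G) : Prop := smallest subgroup A = setT.

Definition residually_finite : Prop :=
  forall g, g <> 1 -> exists2 N, normal_finite_index N & ~ N g.

Definition engulfed H : Prop :=
  exists K, [/\ subgroup K, finite_index K, K <> setT & H `<=` K].

End Subgroups.

Arguments residually_finite : clear implicits.

Section CayleyGraph.
Variables (G : groupType) (A : set G).
Implicit Types (x y z w u v : G) (s : seq G).

Definition cayley_edge : rel G := fun x y => x^-1 * y \in A.

(* The edge path x :: s runs from x to y; it has [size s] edges. *)
Definition edge_path x y s : bool := path cayley_edge x s && (last x s == y).

(* The graph distance on vertices, i.e. the word metric. The default value 0 is
   only taken when x and y are not connected, so never when A generates G. *)
Definition word_dist x y : nat :=
  xget 0%N [set n | (exists2 s, edge_path x y s & size s = n) /\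
                    (forall s, edge_path x y s -> (n <= size s)%N)].

(* A geodesic segment of the Cayley graph with endpoints in G is an edge path
   realizing the distance; it is given by its vertices u :: s. *)
Definition geodesic u v s : Prop := edge_path u v s /\ size s = word_dist u v.

Definition gromov_product x y w : rat :=
  (((word_dist x w)%:R + (word_dist y w)%:R - (word_dist x y)%:R) / 2%:R)%R.

Definition hyperbolic : Prop :=
  exists2 delta : rat, (0 <= delta)%R &
    forall x y z w, (Order.min (gromov_product x z w) (gromov_product y z w)
                       - delta <= gromov_product x y w)%R.

(* Points in the interior of an edge are within 1/2 of a vertex, so it is enough
   to consider the vertices of the segment and an integral constant. *)
Definition quasiconvex (Q : set G) : Prop :=
  exists eta : nat, forall u v, Q u -> Q v ->
    forall s, geodesic u v s -> forall x, x \in u :: s ->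
      exists2 q, Q q & (word_dist x q <= eta)%N.

End CayleyGraph.

Definition profinite (G : groupType) : Type := G.

Section ProfiniteTopology.
Variable G : groupType.
Implicit Types (g : G) (H K N : set G).

Definition profinite_base : set (set G) :=
  [set C | exists g N, normal_finite_index N /\ C = lcoset g N].

Let subgroup1 H : subgroup H -> H 1.
Proof. by case=> + _; rewrite in_setE. Qed.

Let subgroupM H g h : subgroup H -> H g -> H h -> H (g * h).
Proof.
by move=> /group_closedM sH Hg Hh; rewrite -in_setE; apply: sH; rewrite inE.
Qed.

Let subgroupV H g : subgroup H -> H g -> H g^-1.
Proof. by move=> /group_closedV sH Hg; rewrite -in_setE; apply: sH; rewrite inE. Qed.

Let lcosetE g H x : lcoset g H x <-> H (g^-1 * x).
Proof.
split=> [[h Hh <-]|Hx]; first by rewrite mulKg.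
by exists (g^-1 * x) => //; rewrite mulVKg.
Qed.

Let lcoset_eq g H x : subgroup H -> lcoset g H x -> lcoset g H = lcoset x H.
Proof.
move=> sH /lcosetE Hx; apply/seteqP; split=> y /lcosetE Hy; apply/lcosetE.
  have -> : x^-1 * y = (g^-1 * x)^-1 * (g^-1 * y).
    by rewrite invgM invgK -mulgA mulVKg.
  by apply: subgroupM => //; apply: subgroupV.
have -> : g^-1 * y = (g^-1 * x) * (x^-1 * y) by rewrite -mulgA mulVKg.
exact: subgroupM.
Qed.

Let lcosetI g H K : lcoset g (H `&` K) = lcoset g H `&` lcoset g K.
Proof.
apply/seteqP; split=> y.
  by move=> /lcosetE[? ?]; split; apply/lcosetE.
by move=> [/lcosetE ? /lcosetE ?]; apply/lcosetE.
Qed.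

Let normal_finite_indexI H K : normal_finite_index H ->
  normal_finite_index K -> normal_finite_index (H `&` K).
Proof.
move=> [sH nH fH] [sK nK fK]; split.
- split; first by rewrite inE; split; apply: subgroup1.
  move=> x y; rewrite !inE => -[Hx Kx] [Hy Ky].
  by split; apply: subgroupM => //; apply: subgroupV.
- by move=> g n [Hn Kn]; split; [apply: nH | apply: nK].
- apply: (@sub_finite_set _ _ ((fun C => C.1 `&` C.2) @`
    (range (fun g => lcoset g H) `*` range (fun g => lcoset g K)))).
    move=> _ [g _ <-]; exists (lcoset g H, lcoset g K); last by rewrite lcosetI.
    by split=> /=; exists g.
  by apply: finite_image; apply: finite_setX.
Qed.

Let profinite_base_cover : \bigcup_(C in profinite_base) idfun C = setT.
Proof.
rewrite -subTset => g _; exists setT => //; exists 1, setT; split.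
  split=> //; first by split=> [|? ? _ _]; rewrite inE.
  apply: (@sub_finite_set _ _ [set setT]) => // _ [h _ <-] /=.
  by rewrite -subTset => x _; apply/lcosetE.
by apply/esym; rewrite -subTset => x _; apply/lcosetE.
Qed.

Let profinite_base_join (C D : set G) (x : G) :
  profinite_base C -> profinite_base D -> idfun C x -> idfun D x ->
  exists E, [/\ profinite_base E, idfun E x & idfun E `<=` idfun C `&` idfun D].
Proof.
move=> [g [H [nH ->]]] [h [K [nK ->]]] /= xC xD.
exists (lcoset x (H `&` K)); split.
- by exists x, (H `&` K); split=> //; apply: normal_finite_indexI.
- by apply/lcosetE; rewrite mulVg; split; apply: subgroup1; [case: nH|case: nK].
- by rewrite lcosetI (lcoset_eq _ xC) ?(lcoset_eq _ xD)//; [case: nK|case: nH].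
Qed.

HB.instance Definition _ := Choice.on (profinite G).

HB.instance Definition _ := isBaseTopological.Build (profinite G)
  profinite_base_cover profinite_base_join.

End ProfiniteTopology.

Definition GFERF (G : groupType) (A : set G) : Prop :=
  forall H : set G, subgroup H -> quasiconvex A H ->
    closed (H : set (profinite G)).

(* Main.v *)
Require Import Defs.
From mathcomp Require Import all_boot all_order all_algebra.
From mathcomp Require Import boolp classical_sets functions cardinality topology.
From mathcomp Require Import zify lra.

(** Call a subgroup separated from an element a when it is quasiconvex and has a
    in its profinite closure but not among its elements.  If some quasiconvex
    subgroup is not closed, there is a subgroup H separated from some a.  Then H
    is infinite, because residual finiteness makes finite subgroups closed, and it
    has infinite index, because finite index subgroups are closed.  The idea is to
    adjoin finitely many elements to H so that the resulting subgroup J is dense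
    in G and still separated from a.  Such a J is proper and quasiconvex, so it is
    engulfed; but a proper finite index subgroup is closed and cannot contain a
    dense one.

    To bring one more element b into the closure, adjoin to H a long element t and
    y = a t b t a^-1.  As a is in the closure of H, and t and y belong to J, the
    closure of J contains b ([separated_extend]).  Doing this for the generators
    of G makes J dense.  The point is that J should remain quasiconvex and should
    not contain a.  This is a ping-pong argument ([word_group_quasiconvex] and
    [word_group_length]): if the letters y of a symmetric set Y are long compared
    with all the overlaps of y with h and of h y with y', for h in H and y, y' in
    Y (except when h = 1 and y = y'), then reduced products of letters and
    elements of H are quasigeodesics.  So the group that they generate is
    quasiconvex, and its elements outside H are long.  The letters t, t^-1, y and
    y^-1 begin with t, t^-1, a t and a t^-1, so the conditions only concern the
    overlaps of t and t^-1 with H, with a^-1 H, and with their own translates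
    under the elements of H, a^-1 H, H a and a^-1 H a.

    A generic t satisfies these conditions.  If t follows a coset g H for a long
    time, each beginning of t lies in a set g H u with u short; if t follows c t,
    each beginning conjugates c to a short element.  Both happen only in finitely
    many cosets of subgroups of infinite index, namely conjugates of H and
    centralizers, and these do not cover G by B. H. Neumann's lemma ([neumann],
    [generic_prefix]).  The exceptions are the elements c whose centralizer has
    finite index.  They form the FC-center, which is finite
    ([bounded_conj_bounded]); residual finiteness gives a finite index normal
    subgroup that meets it trivially, and H is first intersected with that
    subgroup ([not_closed_separated]).

    Building a long t with a prescribed beginning requires elements that go in
    different directions.  They come from the double cosets of H: cosets of a
    quasiconvex subgroup that are pairwise close have a common point nearby
    ([coset_helly]), so a quasiconvex subgroup of infinite index has arbitrarily
    long double cosets, whose shortest elements are transverse to H on both sides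
    ([transverse]).  Conjugating such an element by far apart elements of H gives
    three independent directions ([three_directions]), of which at least one is
    always free. *)

Set Implicit Arguments.
Unset Strict Implicit.
Unset Printing Implicit Defensive.

Local Open Scope classical_set_scope.
Local Open Scope group_scope.

(** * Subgroups and finite unions of cosets *)

Section SubgroupTheory.
Variable G : groupType.
Implicit Types (g x y : G) (H K : set G).

Lemma subgroup1 H : subgroup H -> H 1.
Proof. by case=> + _; rewrite in_setE. Qed.

Lemma subgroupM H x y : subgroup H -> H x -> H y -> H (x * y).
Proof.
by move=> /group_closedM sH Hx Hy; rewrite -in_setE; apply: sH; rewrite inE.
Qed.

Lemma subgroupV H x : subgroup H -> H x -> H x^-1.
Proof. by move=> /group_closedV sH Hx; rewrite -in_setE; apply: sH; rewrite inE. Qed.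

Lemma subgroupP H : H 1 -> (forall x y, H x -> H y -> H (x * y)) ->
  (forall x, H x -> H x^-1) -> subgroup H.
Proof.
move=> H1 HM HV; split; first by rewrite inE.
by move=> x y; rewrite !inE => Hx Hy; apply/HM => //; apply: HV.
Qed.

Lemma subgroupI H K : subgroup H -> subgroup K -> subgroup (H `&` K).
Proof.
move=> sH sK; apply: subgroupP => [|x y [? ?] [? ?]|x [? ?]].
- by split; apply: subgroup1.
- by split; apply: subgroupM.
- by split; apply: subgroupV.
Qed.

(** The form of infinite index that Neumann's lemma extends to several subgroups,
    without any counting. *)
Definition infinite_index H := forall l : seq G,
  exists x, forall g, g \in l -> ~ H (g^-1 * x).

Definition conj_set H g : set G := [set x | H (x ^ g)].

Lemma conj_set_subgroup H g : subgroup H -> subgroup (conj_set H g).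
Proof.
move=> sH; apply: subgroupP => [|x y|x]; rewrite /conj_set /=.
- by rewrite conj1g; apply: subgroup1.
- by rewrite conjMg; apply: subgroupM.
- by rewrite conjVg; apply: subgroupV.
Qed.

Lemma conj_set_infinite_index H g :
  infinite_index H -> infinite_index (conj_set H g).
Proof.
move=> iH l; have [x xP] := iH [seq k ^ g | k <- l].
exists (x ^ g^-1) => k kl; rewrite /conj_set /= conjMg conjgKV conjVg.
by apply: xP; apply: map_f.
Qed.

(** B. H. Neumann's lemma.  The cosets of the first subgroup H miss some coset
    x0 H.  If all the cosets covered the group, those of the other subgroups would
    cover x0 H, and finitely many of their translates would replace the cosets of
    H; so H could be dropped from the list. *)
Lemma neumann (Hs : seq (set G)) :
  (forall H, H \in Hs -> subgroup H /\ infinite_index H) ->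
  forall l : seq (G * set G), (forall p, p \in l -> p.2 \in Hs) ->
  exists x, forall p, p \in l -> ~ p.2 (p.1^-1 * x).
Proof.
elim: Hs => [|H Hs IH] HsP l lP.
  by exists 1 => p /lP.
have [sH iH] := HsP H (mem_head _ _).
pose lH := [seq p <- l | p.2 == H]; pose lR := [seq p <- l | p.2 != H].
have [x0 x0P] := iH [seq p.1 | p <- lH].
(* the remaining cosets, together with the translates of those that cover x0 H *)
pose l' := lR ++ [seq (p.1 * x0^-1 * q.1, q.2) | p <- lH, q <- lR].
have [||x xP] := IH _ l'.
- by move=> K KHs; apply: HsP; rewrite inE KHs orbT.
- have lRP q : q \in lR -> q.2 \in Hs.
    by rewrite mem_filter => /andP[/negPf qH /lP]; rewrite inE qH.
  move=> p; rewrite mem_cat => /orP[/lRP//|/allpairsP[[p1 q1] [_ /= q1l ->]]] /=.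
  exact: lRP.
have [[p pl px]|nop] := pselect (exists2 p, p \in lH & p.2 (p.1^-1 * x)); last first.
  exists x => p pl px; case: (eqVneq p.2 H) => pH.
    by apply: nop; exists p => //; rewrite mem_filter pH eqxx.
  by apply: (xP p) => //; rewrite mem_cat mem_filter pH pl.
(* x lies in a coset p.1 H, whose translate by x0 * p.1^-1 is the coset x0 H *)
have p2H : p.2 = H by move: pl; rewrite mem_filter => /andP[/eqP].
rewrite p2H in px.
exists (x0 * p.1^-1 * x) => q ql qx; case: (eqVneq q.2 H) => qH.
  apply: (x0P q.1); first by apply: map_f; rewrite mem_filter qH eqxx.
  have -> : q.1^-1 * x0 = q.1^-1 * (x0 * p.1^-1 * x) * (p.1^-1 * x)^-1.
    by rewrite invgM invgK !mulgA mulgK mulgVK.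
  by apply: subgroupM => //; [rewrite -qH|apply: subgroupV].
apply: (xP (p.1 * x0^-1 * q.1, q.2)).
  rewrite mem_cat; apply/orP; right.
  by apply/allpairsP; exists (p, q); split=> //; rewrite mem_filter qH ql.
by rewrite /= !invgM invgK -!mulgA in qx *.
Qed.

End SubgroupTheory.

(** * Hyperbolic geometry of quasiconvex subgroups *)

(** All that is used of the Cayley graph: a left invariant integral metric with
    finite balls in which any two points are joined by a discrete geodesic, and
    the four point condition, which is hyperbolicity for twice the Gromov
    product. *)
Record hyperbolic_metric (G : groupType) (d : G -> G -> nat) (D : nat) : Prop :=
  HyperbolicMetric {
  dist_refl : forall x, d x x = 0%N;
  dist_sym : forall x y, d x y = d y x;
  dist_triangle : forall x y z, (d x z <= d x y + d y z)%N;
  dist_mulg : forall g x y, d (g * x) (g * y) = d x y;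
  dist_four_point : forall x y z w,
    (d x y + d z w <= maxn (d x z + d y w) (d x w + d y z) + D)%N;
  dist_between : forall x y k, (k <= d x y)%N ->
    exists2 z, d x z = k & d z y = (d x y - k)%N;
  finite_ball : forall r, exists B : seq G, forall x, (d 1%g x <= r)%N -> x \in B
}.

Section HyperbolicGeometry.
Variables (G : groupType) (d : G -> G -> nat) (D : nat).
Hypothesis hm : hyperbolic_metric d D.
Implicit Types (u v w x y z g h : G) (Q H : set G) (C E r : nat).

Let dxx := dist_refl hm.
Let dC := dist_sym hm.
Let dT := dist_triangle hm.
Let dL := dist_mulg hm.
Let d4 := dist_four_point hm.

Local Notation len x := (d 1%g x).

(** Twice the Gromov product of x and y at w is at most C.  Read with w in the
    middle, it says that w is, up to C, on a geodesic from x to y. *)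
Definition gromov_le C w x y : Prop := (d x w + d y w <= d x y + C)%N.

(* Linear arithmetic modulo the symmetry of the distance.  Convertible points are
   first made syntactically equal: their group operations may be inferred along
   different paths of the hierarchy. *)
Ltac dist_norm := repeat match goal with |- context[d ?x ?y] =>
  match goal with
  | |- context[d x x] => rewrite (dxx x)
  | |- context[d ?x' ?y'] =>
      tryif (constr_eq x x'; constr_eq y y') then fail
      else (unify x x'; unify y y'; change (d x' y') with (d x y))
  | |- context[d ?y' ?x'] =>
      tryif (constr_eq x x'; constr_eq y y'; constr_eq x y) then fail
      else (unify x x'; unify y y'; rewrite (dC y' x'))
  end end.
Ltac dist_lia := unfold gromov_le in *;
  repeat match goal with
  | H : is_true (leq _ _) |- _ => revert H
  | H : @eq nat _ _ |- _ => revert H end;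
  dist_norm; lia.
Ltac gsimpl := rewrite ?(invgM, invgK, invg1, mulgA, mulgV, mulVg, mul1g, mulg1,
  mulgK, mulgVK).

Lemma distE x y : d x y = len (x^-1 * y).
Proof. by rewrite -(dL x 1) mulg1 mulVKg. Qed.

Lemma dist_mul x y : d x (x * y) = len y.
Proof. by rewrite distE mulKg. Qed.

Lemma lenV x : len x^-1 = len x.
Proof. by rewrite -(dL x) mulg1 mulgV dC. Qed.

Lemma len1 : len 1 = 0%N. Proof. exact: dxx. Qed.

Lemma lenM x y : (len (x * y) <= len x + len y)%N.
Proof. by have := dT 1 x (x * y); rewrite dist_mul. Qed.

Lemma gromov_le_sym C w x y : gromov_le C w x y -> gromov_le C w y x.
Proof. move=> *; dist_lia. Qed.

Lemma gromov_le_mulg C g w x y :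
  gromov_le C (g * w) (g * x) (g * y) <-> gromov_le C w x y.
Proof. by rewrite /gromov_le !dL. Qed.

Lemma gromov_le_weaken C E w x y : (C <= E)%N ->
  gromov_le C w x y -> gromov_le E w x y.
Proof. move=> *; dist_lia. Qed.

Definition near Q x r : Prop := exists2 q, Q q & (d x q <= r)%N.

Definition quasiconvex_dist Q : Prop := exists eta : nat,
  forall u v x, Q u -> Q v -> (d u x + d x v)%N = d u v -> near Q x eta.

(** A point that is almost on a geodesic is close to the point of the geodesic at
    the same distance from its origin. *)
Lemma quasiconvex_near Q : quasiconvex_dist Q -> exists eta, forall u v x E,
  Q u -> Q v -> gromov_le E x u v -> near Q x (E + eta).
Proof.
move=> [eta etaP]; exists (D + eta)%N => u v x E Qu Qv uvx.
have [z uz zv] : exists2 z, d u z = minn (d u x) (d u v) &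
    d z v = (d u v - minn (d u x) (d u v))%N.
  by apply: (dist_between hm); apply: geq_minr.
have [|q Qq zq] := etaP u v z Qu Qv; first by dist_lia.
exists q => //; have := d4 x z u v; have := dT x z q; dist_lia.
Qed.

(** If the geodesics from p to x and to q stayed together for long, the second one,
    and then Q itself, would contain points nearer to x than p. *)
Lemma nearest_point Q : quasiconvex_dist Q -> exists C, forall x p,
  Q p -> (forall q, Q q -> d x p <= d x q)%N ->
  forall q, Q q -> gromov_le C p x q.
Proof.
move=> [eta etaP]; exists (2 * (D + eta) + 2)%N => x p Qp pmin q Qq.
pose k := ((d x p + d q p - d x q)./2)%N.
have := dT x p q; have := dT p x q; have := dT x q p => T1 T2 T3.
have [|z pz zq] := @dist_between _ _ _ hm p q k; first by rewrite /k; dist_lia.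
have [|q' Qq' zq'] := etaP p q z Qp Qq; first by rewrite /k in pz zq *; dist_lia.
have := d4 x z p q; have := dT x z q'; have := pmin q' Qq'.
by rewrite /k in pz zq *; dist_lia.
Qed.

Lemma nearest_point_exists Q x : (exists q, Q q) ->
  exists2 p, Q p & forall q, Q q -> (d x p <= d x q)%N.
Proof.
move=> [q0 Qq0]; pose P n := `[<exists2 q, Q q & d x q = n>].
have exP : exists n, P n by exists (d x q0); apply/asboolP; exists q0.
have [n /asboolP[p Qp pn] nmin] := ex_minnP exP.
by exists p => // q Qq; rewrite pn; apply: nmin; apply/asboolP; exists q.
Qed.

Lemma seq_argmax (T : eqType) (f : T -> nat) (l : seq T) i0 : i0 \in l ->
  exists2 i, i \in l & forall j, j \in l -> (f j <= f i)%N.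
Proof.
elim: l i0 => // a l IH i0 _; case: l IH => [|b l] IH.
  by exists a => [|j]; rewrite inE // => /eqP->.
have [i il imax] := IH b (mem_head _ _).
have [ai|ia] := leqP (f a) (f i).
  exists i => [|j]; first by rewrite inE il orbT.
  by rewrite inE => /orP[/eqP->//|/imax].
exists a => [|j]; first exact: mem_head.
rewrite inE => /orP[/eqP->//|/imax jl]; exact: leq_trans jl (ltnW ia).
Qed.

(** Helly property.  The common point p is the projection of 1 to the coset that
    is the furthest from 1.  A geodesic from 1 to a place where this coset meets
    another one passes by p, but only after the projection of 1 to the other coset,
    which it then follows.  The radius does not depend on the number of cosets. *)
Lemma coset_helly H r : subgroup H -> quasiconvex_dist H ->
  exists R, forall l : seq G,
  (forall g g', g \in l -> g' \in l -> exists q q',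
     [/\ H (g^-1 * q), H (g'^-1 * q') & (d q q' <= r)%N]) ->
  exists p, forall g, g \in l -> exists2 q, H (g^-1 * q) & (d p q <= R)%N.
Proof.
move=> sH qH; have [C CP] := nearest_point qH.
have [eta etaP] := quasiconvex_near qH.
exists (2 * C + 4 * r + D + eta)%N => l lP.
have [pr prP] : {pr : G -> G & forall g, H (g^-1 * pr g) /\
    forall q, H (g^-1 * q) -> (len (pr g) <= len q)%N}.
  apply: (@choice _ _ (fun g p => H (g^-1 * p) /\
    forall q, H (g^-1 * q) -> (len p <= len q)%N)) => g.
  have [|p] := @nearest_point_exists [set q | H (g^-1 * q)] 1.
    by exists g => /=; rewrite mulVg; apply: subgroup1.
  by exists p.
have prG g q : H (g^-1 * q) -> gromov_le C (pr g) 1 q.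
  move=> gq; have [gp pmin] := prP g.
  apply/(gromov_le_mulg _ g^-1); apply: CP => // h Hh.
  by rewrite -(mulKg g h) !dL; apply: pmin; rewrite mulKg.
have [->|[g0 g0l]] : l = [::] \/ exists g0, g0 \in l.
- by case: l {lP} => [|g l]; [left|right; exists g; apply: mem_head].
- by exists 1.
have [i il imax] := seq_argmax (fun g => len (pr g)) g0l.
exists (pr i) => j jl; have [q [q' [jq iq' qq']]] := lP j i jl il.
have [jp _] := prP j.
have nearj : gromov_le (2 * C + 4 * r + D) (pr i) (pr j) q.
  have := imax j jl; have := prG j q jq; have := prG i q' iq'.
  have := d4 1 q (pr i) (pr j); have := dT 1 q q'.
  have := dT (pr i) q' q; have := dT 1 (pr j) q.
  dist_lia.
have [|h Hh ph] := etaP _ _ (j^-1 * pr i) (2 * C + 4 * r + D)%N jp jq.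
  exact/gromov_le_mulg.
by exists (j * h); [rewrite mulKg|rewrite -(dL j^-1) mulKg].
Qed.

Lemma infinite_index_pairwise H : infinite_index H -> forall n, exists2 l : seq G,
  size l = n & pairwise (fun x g => `[< ~ H (g^-1 * x) >]) l.
Proof.
move=> iH; elim=> [|n [l ln lP]]; first by exists [::].
have [x xP] := iH l; exists (x :: l) => /=; rewrite ?ln // lP andbT.
by apply/allP => g gl; apply/asboolP/xP.
Qed.

(** If every double coset came close to 1, any two cosets of H would be close to
    each other, so arbitrarily many of them would come near one point; but they
    are disjoint, and balls are finite. *)
Lemma far_double_coset H r : subgroup H -> quasiconvex_dist H ->
  infinite_index H ->
  exists g, forall h h', H h -> H h' -> (r < len (h * g * h'))%N.
Proof.
move=> sH qH iH; have [R RP] := coset_helly r sH qH; apply: contrapT => near1.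
have close g : exists h h', [/\ H h, H h' & (len (h * g * h') <= r)%N].
  apply: contrapT => far; apply: near1; exists g => h h' Hh Hh'.
  by rewrite ltnNge; apply/negP => le; apply: far; exists h, h'.
have [B BP] := finite_ball hm R.
have [l ln lP] := infinite_index_pairwise iH (size B).+1.
have [|p pP] := RP l.
  move=> g g' _ _; have [h [h' [Hh Hh' le]]] := close (g^-1 * g').
  exists (g * h^-1), (g' * h'); rewrite !mulKg; split=> //; first exact: subgroupV.
  by rewrite distE invgM invgK; rewrite !mulgA in le *.
have [c cP] : {c : G -> G & forall g, g \in l ->
    H (g^-1 * c g) /\ (d p (c g) <= R)%N}.
  apply: (@choice _ _ (fun g q => g \in l -> H (g^-1 * q) /\ (d p q <= R)%N)) => g.
  have [/pP[q ? ?]|_] := boolP (g \in l); first by exists q.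
  by exists 1.
have : uniq [seq p^-1 * c g | g <- l].
  rewrite uniq_pairwise pairwise_map.
  apply: (sub_in_pairwise (P := mem l)) lP; last exact/allP.
  move=> g g' gl g'l /asboolP gg'; apply/eqP => /mulgI cE; apply: gg'.
  have [gc _] := cP g gl; have [g'c _] := cP g' g'l.
  have -> : g'^-1 * g = (g'^-1 * c g') * (g^-1 * c g)^-1 by rewrite cE; gsimpl.
  by apply: subgroupM => //; apply: subgroupV.
move=> /uniq_leq_size -/(_ B); rewrite size_map ln ltnn => inB.
suff : false by [].
by apply: inB => _ /mapP[g gl ->]; apply: BP; rewrite -distE; case: (cP g gl).
Qed.

(** The shortest elements of far away double cosets leave H at once, in both
    directions. *)
Lemma transverse H : subgroup H -> quasiconvex_dist H -> infinite_index H ->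
  exists C, forall L, exists w, [/\ (L <= len w)%N,
    forall h, H h -> gromov_le C 1 w h & forall h, H h -> gromov_le C 1 w^-1 h].
Proof.
move=> sH qH iH; have [C CP] := nearest_point qH; exists C => L.
have [g gP] := far_double_coset L sH qH iH.
pose Q := [set x | exists h h', [/\ H h, H h' & x = h * g * h']].
have H1 := subgroup1 sH.
have [|w Qw wmin] := @nearest_point_exists Q 1; first by exists g, 1, 1; gsimpl.
exists w; have [h0 [h0' [Hh0 Hh0' wE]]] := Qw; split.
- by rewrite wE; apply/ltnW/gP.
- apply: CP => // h Hh; rewrite (dC w) (distE w) -(lenV (w^-1 * h)) invgM invgK wmin //.
  exists (h^-1 * h0), h0'; split; rewrite ?wE ?mulgA //.
  by apply: subgroupM => //; apply: subgroupV.
apply: CP => // h Hh; rewrite (dC w^-1) lenV (distE w^-1) invgK wmin //.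
by exists h0, (h0' * h); split; rewrite ?wE ?mulgA //; apply: subgroupM.
Qed.

Definition unbounded H := forall r, exists2 h, H h & (r < len h)%N.

Lemma transverse_translates C H w (k : G) : (forall h, H h -> gromov_le C 1 w h) ->
  H k -> H k^-1 -> (C + D < len k)%N ->
  (2 * len w <= d w (k * w) + (2 * C + D))%N.
Proof.
move=> wP Hk HVk kbig; have := wP _ Hk; have := wP _ HVk.
have := d4 w k 1 (k * w); rewrite /gromov_le dist_mul.
have -> : d w k^-1 = len (k * w) by rewrite dC distE invgK.
rewrite !(dC _ 1) lenV; dist_lia.
Qed.

(** The elements are the conjugates of a long transverse element by three far
    apart elements of H.  The bound depends only on the conjugating elements, so
    the transverse one can be taken as long as needed. *)
Lemma three_directions H : subgroup H -> quasiconvex_dist H ->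
  infinite_index H -> unbounded H ->
  exists C, forall L, exists f : 'I_3 -> G, (forall i, L <= len (f i))%N /\
    forall i j, i != j ->
    gromov_le C 1 (f i) (f j) /\ gromov_le C 1 (f i)^-1 (f j)^-1.
Proof.
move=> sH qH iH uH; have [C CP] := transverse sH qH iH.
have [h1 Hh1 h1big] := uH (C + D)%N.
have [h2 Hh2 h2big] := uH (C + D + len h1)%N.
pose h (i : 'I_3) := nth 1 [:: 1; h1; h2] i.
have Hh i : H (h i).
  by case: i => [[|[|[|//]]] ?] //; apply: subgroup1.
have hlen i : (len (h i) <= len h2)%N.
  by case: i => [[|[|[|//]]] ?]; rewrite /h /= ?len1; lia.
have hfar i j : i != j -> (C + D < len ((h i)^-1 * h j))%N.
  have far12 : (C + D < len (h1^-1 * h2))%N.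
    by have := lenM h1 (h1^-1 * h2); rewrite mulVKg; lia.
  have far21 : (C + D < len (h2^-1 * h1))%N by rewrite -lenV invgM invgK.
  case: i => [[|[|[|//]]] ?]; case: j => [[|[|[|//]]] ?] //= _;
    by rewrite /h /= ?invg1 ?mul1g ?mulg1 ?lenV //; lia.
clearbody h.
have diverge w : (forall k, H k -> gromov_le C 1 w k) -> forall i j, i != j ->
    gromov_le (2 * C + D + 6 * len h2) 1 (h i * w * (h i)^-1) (h j * w * (h j)^-1).
  move=> wP i j ij; have Hk : H ((h i)^-1 * h j).
    by apply: subgroupM => //; apply: subgroupV.
  have := transverse_translates wP Hk (subgroupV sH Hk) (hfar i j ij).
  rewrite -(dL (h i) w) -!mulgA mulVKg !mulgA.
  have lenf m : (len (h m * w * (h m)^-1) <= len w + 2 * len (h m))%N.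
    by have := lenM (h m * w) (h m)^-1; have := lenM (h m) w; rewrite lenV; dist_lia.
  have := lenf i; have := lenf j; have := hlen i; have := hlen j.
  have := dist_mul (h i * w) (h i)^-1; have := dist_mul (h j * w) (h j)^-1.
  have := dT (h i * w) (h i * w * (h i)^-1) (h j * w).
  have := dT (h i * w * (h i)^-1) (h j * w * (h j)^-1) (h j * w).
  rewrite !lenV; dist_lia.
exists (2 * C + D + 6 * len h2)%N => L.
have [w [wbig wP wVP]] := CP (L + 2 * len h2)%N.
exists (fun i => h i * w * (h i)^-1); split=> [i|i j ij].
  have := lenM ((h i)^-1 * (h i * w * (h i)^-1)) (h i).
  have := lenM (h i)^-1 (h i * w * (h i)^-1).
  by have := hlen i; rewrite !mulgA mulVg mul1g mulgVK lenV; lia.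
split; first exact: diverge.
by have := diverge _ wVP i j ij; rewrite -!mulgA !invgM !invgK -!mulgA.
Qed.

(** Two directions that both overlap much with x overlap much with each other. *)
Lemma avoid_direction (I : eqType) (f : I -> G) C x (i0 : I) :
  (forall i j, i != j -> gromov_le C 1 (f i) (f j)) ->
  exists i, forall j, j != i -> gromov_le (C + D) 1 x (f j).
Proof.
move=> fP.
have [[i iP]|nobad] := pselect (exists i, ~ gromov_le (C + D) 1 x (f i)).
  exists i => j ji; have := fP _ _ ji; have := d4 (f j) (f i) x 1.
  by move: iP; rewrite /gromov_le => /negP; rewrite -ltnNge; dist_lia.
by exists i0 => j _; apply: contrapT => bad; apply: nobad; exists j.
Qed.

Lemma third_ord (i j : 'I_3) : exists2 k : 'I_3, k != i & k != j.
Proof.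
case: i j => [[|[|[|//]]] ?] [[|[|[|//]]] ?];
  by [exists (@Ordinal 3 0 isT)|exists (@Ordinal 3 1 isT)|exists (@Ordinal 3 2 isT)].
Qed.

(** Two turns on a path compose, provided that the piece between them is long. *)
Lemma long_middle C x f y : gromov_le C 1 x^-1 f -> gromov_le C 1 f^-1 y ->
  (2 * C + D < 2 * len f)%N ->
  (len x + len f + len y <= len (x * f * y) + (2 * C + D))%N.
Proof.
rewrite /gromov_le ![d _ 1]dC !lenV => xf fy fbig.
move: xf fy; have -> : d x^-1 f = len (x * f) by rewrite distE invgK.
have -> : d f^-1 y = len (f * y) by rewrite distE invgK.
have := d4 1 (x * f) x (x * f * y); rewrite !dist_mul.
have -> : d x (x * f * y) = len (f * y) by rewrite -mulgA dist_mul.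
by rewrite (dC (x * f) x) dist_mul; lia.
Qed.

(** One of three independent directions f is opposed neither to the end of x nor to
    the beginning of y, so there is little cancellation in x f y. *)
Lemma concatenation H : subgroup H -> quasiconvex_dist H ->
  infinite_index H -> unbounded H ->
  exists C, forall x y, exists2 f, (len f <= C)%N &
    (len x + len y <= len (x * f * y) + C)%N.
Proof.
move=> sH qH iH uH; have [C CP] := three_directions sH qH iH uH.
have [f [fbig fP]] := CP (2 * C + 3 * D).+1%N.
exists (2 * (C + D) + D + \max_i len (f i))%N => x y.
have [i iP] := @avoid_direction _ f C x^-1 ord0 (fun i j ij => (fP i j ij).1).
have [j jP] := @avoid_direction _ (fun i => (f i)^-1) C y ord0
  (fun i j ij => (fP i j ij).2).
have [k ki kj] := third_ord i j.
have fk : (len (f k) <= \max_i len (f i))%N.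
  exact: (@leq_bigmax _ (fun i : 'I_3 => len (f i))).
exists (f k); first by lia.
have := long_middle (iP k ki) (gromov_le_sym (jP k kj)); have := fbig k; lia.
Qed.

(** As balls are finite, this is the FC-center: the set of the elements with
    finitely many conjugates. *)
Definition bounded_conj : set G := [set c | exists K, forall q, (len (c ^ q) <= K)%N].

Lemma bounded_conj_subgroup : subgroup bounded_conj.
Proof.
apply: subgroupP => [|x y [K KP] [K' K'P]|x [K KP]].
- by exists 0%N => q; rewrite conj1g len1.
- exists (K + K')%N => q; rewrite conjMg; apply: leq_trans (lenM _ _) _.
  exact: leq_add.
- by exists K => q; rewrite conjVg lenV.
Qed.

Lemma bounded_conjJ c g : bounded_conj (c ^ g) <-> bounded_conj c.
Proof.
split=> -[K KP]; exists K => q; last by rewrite -conjgM.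
by have := KP (g^-1 * q); rewrite conjgM conjgK.
Qed.

(** A long element c can be conjugated to a longer one, by a long element that
    avoids the directions of c and of its inverse. *)
Lemma bounded_conj_bounded H : subgroup H -> quasiconvex_dist H ->
  infinite_index H -> unbounded H ->
  exists K, forall c, bounded_conj c -> (len c <= K)%N.
Proof.
move=> sH qH iH uH; have [C CP] := three_directions sH qH iH uH.
have [f [fbig fP]] := CP (2 * C + 4 * D).+1%N.
have longer c : (C + 2 * D < len c)%N -> exists q, (len c < len (c ^ q))%N.
  move=> cbig; have fP1 i j ij := (fP i j ij).1.
  have [i iP] := avoid_direction c ord0 fP1.
  have [j jP] := avoid_direction c^-1 ord0 fP1.
  have [k ki kj] := third_ord i j; exists (f k).
  have := iP k ki; have := jP k kj; have := d4 (f k) c 1 (c * f k).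
  rewrite /gromov_le !(dC _ 1) lenV dist_mul.
  have -> : d c^-1 (f k) = len (c * f k) by rewrite distE invgK.
  have -> : d (f k) (c * f k) = len (c ^ f k) by rewrite distE.
  have := fbig k; dist_lia.
exists (C + 2 * D)%N => c [K KP]; rewrite leqNgt; apply/negP => cbig.
have grow n : exists q, (len c + n <= len (c ^ q))%N.
  elim: n => [|n [q qn]]; first by exists 1; rewrite conjg1 addn0.
  have [|p] := longer (c ^ q); first by lia.
  by exists (q * p); rewrite conjgM; lia.
have [q qK] := grow K.+1; have := KP q; lia.
Qed.

Definition centralizer (c : G) : set G := [set x | c ^ x = c].

Lemma centralizer_subgroup c : subgroup (centralizer c).
Proof.
apply: subgroupP => [|x y xc yc|x xc]; rewrite /centralizer /=.
- exact: conjg1.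
- by rewrite conjgM xc.
- by rewrite -[in LHS]xc conjgK.
Qed.

Lemma centralizer_infinite_index c :
  ~ bounded_conj c -> infinite_index (centralizer c).
Proof.
move=> cN l; apply: contrapT => cov; apply: cN.
exists (\max_(g <- l) len (c ^ g^-1))%N => q.
have [g gl gq] : exists2 g, g \in l & centralizer c (g^-1 * q^-1).
  apply: contrapT => nog; apply: cov; exists q^-1 => g gl gq.
  by apply: nog; exists g.
have -> : c ^ q = c ^ g^-1 by rewrite -[in LHS]gq conjgM conjgKV.
exact: (@leq_bigmax_seq _ l xpredT (fun g => len (c ^ g^-1)) g).
Qed.

(** The elements that conjugate one given element to another one form a coset of
    a centralizer, so Neumann's lemma provides an element that makes finitely
    many given elements long. *)
Lemma spread_conjugates r K :
  exists x, forall c, (len c <= r)%N -> ~ bounded_conj c -> (K < len (c ^ x))%N.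
Proof.
have [B BP] := finite_ball hm r; have [B' B'P] := finite_ball hm K.
have [cj cjP] : {cj : G * G -> G & forall p,
    (exists x, p.1 ^ x = p.2) -> p.1 ^ cj p = p.2}.
  apply: (@choice _ _ (fun p y => (exists x, p.1 ^ x = p.2) -> p.1 ^ y = p.2)) => p.
  have [[x xp]|no] := pselect (exists x, p.1 ^ x = p.2); first by exists x.
  by exists 1.
pose B'N := [seq c <- B' | `[< ~ bounded_conj c >]].
have [||x xP] := @neumann G [seq centralizer c | c <- B'N] _
    [seq (cj (c, c'), centralizer c') | c <- B, c' <- B'N].
- move=> C /mapP[c]; rewrite mem_filter => /andP[/asboolP cN _ ->].
  by split; [apply: centralizer_subgroup|apply: centralizer_infinite_index].
- by move=> _ /allpairsP[[c c'] [_ cB' ->]]; apply: map_f.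
exists x => c cr cN; rewrite ltnNge; apply/negP => cK.
apply: (xP (cj (c, c ^ x), centralizer (c ^ x))).
  apply/allpairsP; exists (c, c ^ x); split=> //=; first exact: BP.
  rewrite mem_filter; apply/andP; split; last exact: B'P.
  by apply/asboolP; rewrite bounded_conjJ.
have /= cjE := cjP (c, c ^ x) (ex_intro _ x erefl).
move: (cj _) cjE => y cjE.
by rewrite /centralizer /= -[in LHS]cjE conjgM conjgK.
Qed.

Lemma far_from_cosets H (l : seq G) r : subgroup H -> infinite_index H ->
  exists x, forall g h, g \in l -> H h -> (r < len (x^-1 * g * h))%N.
Proof.
move=> sH iH; have [B BP] := finite_ball hm r.
have [||x xP] := @neumann G [seq conj_set H u^-1 | u <- B] _
    [seq (g * u, conj_set H u^-1) | g <- l, u <- B].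
- move=> K /mapP[u _ ->].
  by split; [apply: conj_set_subgroup|apply: conj_set_infinite_index].
- by move=> _ /allpairsP[[g u] [_ uB ->]]; apply: map_f.
exists x => g h gl Hh; rewrite ltnNge; apply/negP => xr.
pose u := (x^-1 * g * h)^-1.
have uB : u \in B by apply: BP; rewrite lenV.
apply: (xP (g * u, conj_set H u^-1)).
  by apply/allpairsP; exists (g, u).
rewrite /conj_set /= conjgE invgK !mulgA.
suff -> : u * (g * u)^-1 * x * u^-1 = h^-1^-1 by rewrite invgK.
by rewrite /u; gsimpl.
Qed.

(** The beginning x is a product of w0 and w1.  The part w0 is chosen far from the
    cosets H and a^-1 H, so a path through w0 leaves these cosets at a bounded
    distance.  Only then is it known which translations c are so short that they
    could move the path to a nearby one, and w1 is chosen so that x^-1 c x is long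
    for all of them; a longer c moves the path to one that goes in the direction
    of a coset, which the path has left. *)
Lemma generic_prefix H a r k : subgroup H -> quasiconvex_dist H ->
  infinite_index H -> unbounded H ->
  exists x C, forall t t', gromov_le k x 1 t -> gromov_le k x 1 t' ->
  (forall g h, g \in [:: 1; a] -> H h -> gromov_le C 1 t (g^-1 * h)) /\
  forall c, ~ bounded_conj c ->
    ((len c <= r)%N \/ exists g g' h,
      [/\ g \in [:: 1; a], g' \in [:: 1; a], H h & c = g'^-1 * h * g]) ->
    gromov_le C 1 t (c * t').
Proof.
move=> sH qH iH uH; have [eta etaP] := quasiconvex_near qH.
have [C0 C0P] := concatenation sH qH iH uH.
pose la := len a; pose k0 := (2 * C0 + k)%N.
have lg g : g \in [:: 1; a] -> (len g <= la)%N.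
  by rewrite !inE => /orP[/eqP->|/eqP->//]; rewrite len1.
have [w0 w0P] := far_from_cosets [:: 1; a^-1] (k0 + D + 2 * la + eta) sH iH.
pose C1 := (2 * len w0 + D)%N; pose r2 := (r + 2 * C1 + 5 * la + D)%N.
have [w1 w1P] := spread_conjugates (r2 + 2 * (len w0 + C0)) (r2 + k + 2 * D).
have [f fC0 fP] := C0P w0 w1; pose x := w0 * f * w1.
have w0x : (len w0 + d w0 x <= len x + 2 * C0)%N.
  by have := lenM f w1; rewrite /x -mulgA dist_mul mulgA; dist_lia.
have awayH t g h : gromov_le k x 1 t -> g \in [:: 1; a] -> H h ->
    gromov_le C1 1 t (g^-1 * h).
  move=> xt ga Hh; apply: contrapT => /negP; rewrite -ltnNge => big.
  have [|h' Hh' hn] := etaP 1 h (g * w0) (k0 + D + 2 * la)%N (subgroup1 sH) Hh.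
    apply/(gromov_le_mulg _ g^-1); rewrite mulKg mulg1.
    have := lg g ga; have := lenV g; have := dT 1 g^-1 w0; have := dT w0 1 g^-1.
    have := dT 1 g^-1 (g^-1 * h).
    have := d4 w0 (g^-1 * h) 1 t; have := dT w0 x t; have := dT 1 w0 t.
    by rewrite /C1 /k0 in big *; dist_lia.
  have g'l : g^-1 \in [:: 1; a^-1].
    by move: ga; rewrite !inE => /orP[/eqP->|/eqP->]; rewrite ?invg1 eqxx ?orbT.
  have := w0P _ h' g'l Hh'; rewrite -mulgA -distE -(dL g) mulVKg; lia.
pose C := (C1 + D + 2 * len x + D)%N.
exists x, C => t t' xt xt'; split=> [g h ga Hh|c cN cP].
  by have := awayH t g h xt ga Hh; rewrite /C; dist_lia.
have [cr2|cr2] := leqP (len c) r2.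
  (* short c: the paths to t and to c t' cannot be close up to x *)
  have cx : (r2 + k + 2 * D < d x (c * x))%N.
    rewrite distE mulgA -mulgA -/(c ^ x) /x conjgM; apply: w1P.
      have := lenM (w0 * f)^-1 (c * (w0 * f)); have := lenM c (w0 * f).
      by have := lenM w0 f; rewrite lenV conjgE; dist_lia.
    by rewrite bounded_conjJ.
  apply: contrapT => /negP; rewrite -ltnNge => big.
  have := d4 x (c * t') 1 t; have := d4 x (c * x) 1 (c * t'); rewrite !dL.
  have := lenM c x; have := lenM c^-1 (c * t'); rewrite mulKg lenV.
  by rewrite /C in big *; dist_lia.
(* long c: c t' goes in the direction of g'^-1 h *)
have [//|[g [g' [h [ga g'a Hh cE]]]]] := cP; first by rewrite /r2 in cr2 *; lia.
have := awayH t g' h xt g'a Hh; have := awayH t' g h^-1 xt' ga (subgroupV sH Hh).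
rewrite /gromov_le; have := lg g ga; have := lg g' g'a.
have := lenM (g'^-1 * h) g; rewrite -cE.
have -> : c * t' = g'^-1 * h * (g * t') by rewrite cE -!mulgA.
have := d4 t (g'^-1 * h) 1 (g'^-1 * h * (g * t')); rewrite dist_mul.
have -> : d t' (g^-1 * h^-1) = d (g * t') h^-1 by rewrite -(dL g) mulVKg.
have := dT (g * t') (h^-1 * g') h^-1; rewrite (dC (h^-1 * g')) dist_mul.
have -> : d (g * t') (h^-1 * g') = len (g'^-1 * h * (g * t')).
  by rewrite dC distE; gsimpl.
have := lenM g t'; have := lenM g'^-1 h.
have := lenM g (g^-1 * h^-1); rewrite mulVKg.
rewrite !lenV /C; rewrite /r2 in cr2; dist_lia.
Qed.

(** The element is x f e f'^-1 x^-1 with f and f' long in two different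
    directions and e a bounded correction.  It and its inverse begin with x f and
    x f', so they overlap little beyond x. *)
Lemma long_element H : subgroup H -> quasiconvex_dist H ->
  infinite_index H -> unbounded H ->
  exists k, forall x, exists C, forall L, exists t, [/\ (L <= len t)%N,
    gromov_le k x 1 t, gromov_le k x 1 t^-1 & gromov_le C 1 t t^-1].
Proof.
move=> sH qH iH uH; have [C3 C3P] := concatenation sH qH iH uH.
have [C0 C0P] := three_directions sH qH iH uH.
exists (C0 + D + 2 * C3)%N => x; exists (2 * len x + C0 + 2 * D)%N => L.
have [f [fbig fP]] := C0P (L + len x + 2 * C0 + 4 * D + 2 * C3).+1%N.
have fP1 i j ij := (fP i j ij).1.
have [i iP] := avoid_direction x^-1 ord0 fP1.
have [j ji _] := third_ord i i; have [m mi mj] := third_ord i j.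
pose v1 := x * f j; pose v2 := x * f m; have [e eC3 eP] := C3P v1 v2^-1.
have far n : n != i -> (len x + len (f n) <= len (x * f n) + C0 + D)%N.
  move=> /iP; rewrite /gromov_le !(dC _ 1) lenV.
  have -> : d x^-1 (f n) = len (x * f n) by rewrite distE invgK.
  dist_lia.
have := far j ji; have := far m mi; rewrite -/v1 -/v2 => far2 far1.
pose t := v1 * e * v2^-1.
have v1t : (d v1 t <= C3 + len v2)%N.
  by rewrite /t -mulgA dist_mul; have := lenM e v2^-1; rewrite lenV; dist_lia.
have v2t : (d v2 t^-1 <= C3 + len v1)%N.
  have -> : t^-1 = v2 * (e^-1 * v1^-1) by rewrite /t; gsimpl.
  by rewrite dist_mul; have := lenM e^-1 v1^-1; rewrite !lenV; dist_lia.
have := fP1 _ _ mj; have := fbig j; have := fbig m; have := lenV t; have := lenV v2.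
have := dist_mul x (f j); have := dist_mul x (f m); rewrite -/v1 -/v2.
have := dT x v1 t; have := dT x v2 t^-1; have := dL x (f j) (f m).
have := lenM x (f j); have := lenM x (f m); rewrite -/t -/v1 -/v2 in eP *.
rewrite -/v1 -/v2; clearbody v1 v2 t => *.
exists t; split; try by dist_lia.
have := d4 v1 v2 t 1; have := d4 t v2 t^-1 1; dist_lia.
Qed.

(** * Combination with long elements *)

(** Products of elements of H with n letters of Y inserted.  Counting the letters
    makes it possible to work with shortest words, which are reduced. *)
Inductive word H (Y : set G) : nat -> G -> Prop :=
| word0 h : H h -> word H Y 0 h
| wordS n h y g : H h -> Y y -> word H Y n g -> word H Y n.+1 (h * (y * g)).

Definition word_group H (Y : set G) : set G := [set g | exists n, word H Y n g].

Lemma word_mulH H Y n h g : subgroup H -> H h -> word H Y n g ->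
  word H Y n (h * g).
Proof.
move=> sH Hh; case=> [h' Hh'|m h' y g' Hh' Yy g'P].
  by apply: word0; apply: subgroupM.
by rewrite mulgA; apply: wordS => //; apply: subgroupM.
Qed.

Lemma word_cons H Y n y g : subgroup H -> Y y -> word H Y n g ->
  word H Y n.+1 (y * g).
Proof.
by move=> sH Yy gP; rewrite -[y * g]mul1g; apply: wordS => //; apply: subgroup1.
Qed.

Lemma wordM H Y m n g g' : subgroup H -> word H Y m g -> word H Y n g' ->
  word H Y (m + n) (g * g').
Proof.
move=> sH gP g'P; elim: gP => [h Hh|k h y g0 Hh Yy _ IH].
  exact: word_mulH.
by rewrite addSn -!mulgA; apply: wordS => //.
Qed.

Lemma word_group_subgroup H Y : subgroup H -> (forall y, Y y -> Y y^-1) ->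
  subgroup (word_group H Y).
Proof.
move=> sH Ysym; apply: subgroupP.
- by exists 0%N; apply: word0; apply: subgroup1.
- by move=> x y [m xP] [n yP]; exists (m + n)%N; apply: wordM.
move=> x [n xP]; elim: xP => [h Hh|m h y g Hh Yy _ [k IH]].
  by exists 0%N; apply: word0; apply: subgroupV.
exists (k + 1)%N; rewrite !invgM -mulgA; apply: wordM => //.
by apply: word_cons; [| apply: Ysym | apply: word0; apply: subgroupV].
Qed.

Lemma word_group_base H Y : H `<=` word_group H Y.
Proof. by move=> h Hh; exists 0%N; apply: word0. Qed.

Lemma word_group_letter H Y : subgroup H -> Y `<=` word_group H Y.
Proof.
move=> sH y Yy; exists 1%N; rewrite -[y]mulg1.
by apply: word_cons => //; apply: word0; apply: subgroup1.
Qed.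

Lemma minimal_word H Y g : word_group H Y g ->
  exists2 n, word H Y n g & forall m, word H Y m g -> (n <= m)%N.
Proof.
move=> [n0 n0P].
have exP : exists n, `[< word H Y n g >] by exists n0; apply/asboolP.
have [n /asboolP nP nmin] := ex_minnP exP.
by exists n => // m mP; apply/nmin/asboolP.
Qed.

(** The overlap of x with y ends before y does, so it does not grow when y is
    continued to v. *)
Lemma gromov_le_extend C E x y v : gromov_le C 1 x y -> gromov_le E y 1 v ->
  (C + E + D < 2 * len y)%N -> gromov_le (C + D) 1 x v.
Proof. move=> xy yv big; have := d4 x y v 1; dist_lia. Qed.

(** The path from y^-1 to 1, h and h v does not turn back when v begins with a
    long y'.  The conclusion for h v is the assumption on v with the same bound, so
    this can be iterated along a word without the errors adding up. *)
Lemma junction C y h y' v : gromov_le C 1 y^-1 h -> gromov_le C 1 h^-1 y' ->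
  gromov_le C 1 y^-1 (h * y') -> gromov_le (C + D) y' 1 v ->
  (2 * C + 2 * D < len y')%N -> gromov_le (C + D) 1 y^-1 (h * v).
Proof.
move=> yh hy' yhy' y'v big.
have hv : gromov_le (C + D) 1 h^-1 v by apply: (gromov_le_extend hy' y'v); lia.
move: hv hy'; rewrite /gromov_le.
have -> : d h^-1 v = len (h * v) by rewrite distE invgK.
have -> : d h^-1 y' = len (h * y') by rewrite distE invgK.
have := d4 y^-1 (h * y') (h * v) 1; rewrite !dL !(dC _ 1) (lenV h); dist_lia.
Qed.

Section Combination.
Variables (H Y : set G) (C M : nat).
Hypotheses (sH : subgroup H) (qH : quasiconvex_dist H).
Hypothesis (Ysym : forall y, Y y -> Y y^-1).
Hypothesis (Ylong : forall y, Y y -> (2 * C + 3 * D < len y)%N).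
Hypothesis (Ybounded : forall y, Y y -> (len y <= M)%N).
Hypothesis (HY : forall h y, H h -> Y y -> gromov_le C 1 h y).
Hypothesis (YHY : forall h y y', H h -> Y y -> Y y' -> ~ (h = 1 /\ y = y') ->
  gromov_le C 1 (h * y) y').

(** A shortest word is reduced, since two inverse letters next to each other could
    be removed. *)
Let reduced_tail n y h y' g :
  Y y -> H h -> Y y' -> word H Y n g ->
  (forall m, word H Y m (y * (h * (y' * g))) -> (n.+1 < m)%N) ->
  ~ (h = 1 /\ y' = y^-1) /\ (forall m, word H Y m (y' * g) -> (n < m)%N).
Proof.
move=> Yy Hh Yy' gP ymin; split=> [[h1 y'E]|m mP].
  by have := ymin n; rewrite h1 y'E mul1g mulVKg => /(_ gP); lia.
have := ymin m.+1; rewrite ltnS; apply.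
by apply: word_cons => //; apply: word_mulH.
Qed.

Lemma reduced_no_cancel n y g : Y y -> word H Y n g ->
  (forall m, word H Y m (y * g) -> (n < m)%N) -> gromov_le (C + D) 1 y^-1 g.
Proof.
move=> + gP; elim: gP y => {n g} [h Hh|n h y' g Hh Yy' gP IH] y Yy ymin.
  have := HY Hh (Ysym Yy); dist_lia.
have [hy'N y'min] := reduced_tail Yy Hh Yy' gP ymin.
apply: (@junction C y h y').
- exact/gromov_le_sym/HY/Ysym.
- by apply: HY => //; apply: subgroupV.
- apply/gromov_le_sym/YHY => //; first exact: Ysym.
- by apply/(gromov_le_mulg _ y'^-1); rewrite mulVg mulg1 mulKg; apply: IH.
- by have := Ylong Yy'; lia.
Qed.

Lemma word_group_length g : word_group H Y g -> ~ H g ->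
  exists2 y, Y y & (len y <= len g + (2 * C + 2 * D))%N.
Proof.
move=> /minimal_word[n gP gmin] Hg.
case: gP gmin Hg => [h Hh _ /(_ Hh)//|{}n h y {}g Hh Yy gP gmin _].
exists y => //; have := Ylong Yy.
have yg : gromov_le (C + D) 1 y^-1 g.
  apply: (reduced_no_cancel Yy gP) => m mP; apply: gmin.
  exact: word_mulH.
have hyg : gromov_le (C + D) 1 h^-1 (y * g).
  apply: (@gromov_le_extend _ (C + D) _ y).
  - by apply: HY => //; apply: subgroupV.
  - by apply/(gromov_le_mulg _ y^-1); rewrite mulVg mulg1 mulKg.
  - by have := Ylong Yy; lia.
move: yg hyg; rewrite /gromov_le !(dC _ 1) !lenV.
have -> : d y^-1 g = len (y * g) by rewrite distE invgK.
have -> : d h^-1 (y * g) = len (h * (y * g)) by rewrite distE invgK.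
dist_lia.
Qed.

(** The geodesic from 1 to m passes close to the junctions of a reduced word for
    m, so each of its points x is almost between two successive junctions u and
    u h y, and there it is close to the coset u H.  The point x itself is kept, and
    only the junctions advance, so that no error builds up. *)
Theorem word_group_quasiconvex : quasiconvex_dist (word_group H Y).
Proof.
have [eta etaP] := quasiconvex_near qH; pose k := (C + 2 * D)%N.
pose R := (2 * k + 2 * D + 2 * M + eta)%N.
have sJ := word_group_subgroup sH Ysym.
have segment u h y m x : word_group H Y u -> H h -> Y y -> gromov_le k u 1 m ->
    gromov_le k (u * h * y) 1 m -> (len x + d x m)%N = len m ->
    (len u <= len x)%N -> (len x <= len (u * h * y))%N -> near (word_group H Y) x R.
  move=> Ju Hh Yy um u'm xm ux xu'.
  have [|q Hq xq] := etaP 1 h (u^-1 * x) (2 * k + 2 * D + 2 * M)%N (subgroup1 sH) Hh.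
    apply/(gromov_le_mulg _ u); rewrite mulVKg mulg1.
    have := d4 u x 1 m; have := d4 (u * h * y) x 1 m.
    have := dist_mul (u * h) y; have := Ybounded Yy.
    have := dT x (u * h * y) (u * h); have := dT 1 u (u * h).
    have := dT 1 (u * h) (u * h * y); dist_lia.
  exists (u * q); first by apply: subgroupM => //; apply: word_group_base.
  by rewrite -(dL u^-1) mulKg.
have junction_near n u y g : Y y -> gromov_le (C + D) y^-1 1 u^-1 ->
    word H Y n g -> (forall m, word H Y m (y * g) -> (n < m)%N) ->
    gromov_le k u 1 (u * g).
  move=> Yy yu gP ymin; apply/(gromov_le_mulg _ u^-1).
  rewrite mulVg mulg1 mulKg; apply: gromov_le_sym.
  apply: (@gromov_le_weaken (C + D + D)); first by rewrite /k; lia.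
  apply: gromov_le_extend (gromov_le_sym (reduced_no_cancel Yy gP ymin)) yu _.
  by rewrite lenV; have := Ylong Yy; lia.
have after n u y g x : word H Y n g -> word_group H Y u -> Y y ->
    gromov_le (C + D) y^-1 1 u^-1 ->
    (forall m, word H Y m (y * g) -> (n < m)%N) ->
    (len x + d x (u * g))%N = len (u * g) -> (len u <= len x)%N ->
    near (word_group H Y) x R.
  move=> gP; elim: gP u y => {n g} [h Hh|n h y' g Hh Yy' gP IH] u y Ju Yy yu ymin.
    move=> xm ux.
    have um := junction_near _ _ _ _ Yy yu (word0 Y Hh) ymin.
    have [|q Hq xq] := etaP 1 h (u^-1 * x) (k + D)%N (subgroup1 sH) Hh.
      apply/(gromov_le_mulg _ u); rewrite mulVKg mulg1.
      have := d4 u x 1 (u * h); have := dT 1 u (u * h); dist_lia.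
    exists (u * q); first by apply: subgroupM => //; apply: word_group_base.
    by rewrite -(dL u^-1) mulKg /R; dist_lia.
  have [hy'N y'min] := reduced_tail Yy Hh Yy' gP ymin.
  have um := junction_near _ _ _ _ Yy yu (wordS Hh Yy' gP) ymin.
  have u'E : u * (h * (y' * g)) = u * h * y' * g by rewrite !mulgA.
  have y'u' : gromov_le (C + D) y'^-1 1 (u * h * y')^-1.
    apply/(gromov_le_mulg _ y'); rewrite mulgV mulg1 !invgM mulVKg.
    rewrite -[y' in gromov_le _ _ y' _]invgK.
    apply: (@junction C y'^-1 h^-1 y^-1); rewrite ?invgK //.
    - by apply/gromov_le_sym/HY => //; apply: subgroupV.
    - exact/HY/Ysym.
    - apply/gromov_le_sym/YHY => //; [exact: subgroupV|exact: Ysym|].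
      by move=> [hV1 yE]; apply: hy'N; rewrite -yE -[h]invgK hV1 invg1.
    - by rewrite lenV; have := Ylong Yy; lia.
  have u'm := junction_near _ _ _ _ Yy' y'u' gP y'min.
  rewrite u'E in um *; move=> xm ux.
  have [xu'|u'x] := leqP (len x) (len (u * h * y')).
    exact: (@segment u h y' (u * h * y' * g)).
  apply: (IH (u * h * y') y') => //; last exact: ltnW.
  apply: subgroupM => //; last exact: word_group_letter.
  by apply: subgroupM => //; apply: word_group_base.
have from1 m x : word_group H Y m -> (len x + d x m)%N = len m -> near (word_group H Y) x R.
  move=> /minimal_word[n mP]; case: mP => [h Hh _ xh|{}n h y g Hh Yy gP mmin].
    have [|q Hq xq] := etaP 1 h x 0%N (subgroup1 sH) Hh; first by dist_lia.
    by exists q; [apply: word_group_base|rewrite /R; dist_lia].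
  have ymin l : word H Y l (y * g) -> (n < l)%N.
    by move=> lP; apply: mmin; apply: word_mulH.
  have yu : gromov_le (C + D) y^-1 1 (h * y)^-1.
    apply/(gromov_le_mulg _ y); rewrite mulgV mulg1 invgM mulVKg.
    have := HY (subgroupV sH Hh) Yy; dist_lia.
  have Jhy : word_group H Y (h * y).
    by apply: subgroupM => //; [apply: word_group_base|apply: word_group_letter].
  have um := junction_near _ _ _ _ Yy yu gP ymin.
  rewrite mulgA => xm.
  have [xu'|u'x] := leqP (len x) (len (h * y)).
    apply: (@segment 1 h y (h * y * g)); rewrite ?mul1g //.
    - exact: subgroup1.
    - by rewrite /gromov_le dxx dC; lia.
    - by rewrite len1.
  by apply: (after n (h * y) y g) => //; apply: ltnW.
exists R => u v x Ju Jv uxv.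
have [||q Jq xq] := from1 (u^-1 * v) (u^-1 * x).
- by apply: subgroupM => //; apply: subgroupV.
- by rewrite -(dL u) -[d (u^-1 * x) _](dL u) -[RHS](dL u) !mulVKg !mulg1.
exists (u * q); first exact: subgroupM.
by rewrite -(dL u^-1) mulKg.
Qed.

End Combination.

(** Modulo H, the letters t, t^-1, y, y^-1 begin with g t and g t^-1 for g = 1 or
    g = a.  Two of these beginnings overlap as much as one of t, t^-1 overlaps with
    the translate of one of them by g'^-1 h g, which by the assumptions on H and a
    lies in the FC-center only if h = 1 and g = g'; so a generic t applies. *)
Theorem extend_subgroup H a b : subgroup H -> quasiconvex_dist H ->
  infinite_index H -> unbounded H ->
  (forall c, H c -> bounded_conj c -> c = 1) ->
  (forall h, H h -> ~ bounded_conj (a * h)) -> ~ bounded_conj b ->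
  exists J t, [/\ [/\ subgroup J, quasiconvex_dist J & H `<=` J],
    J t, J (a * t * b * t * a^-1),
    forall c, J c -> bounded_conj c -> c = 1 &
    forall m, J m -> ~ bounded_conj (a * m)].
Proof.
move=> sH qH iH uH HN aHN bN.
have sN := bounded_conj_subgroup; have N1 := subgroup1 sN.
have [K KP] := bounded_conj_bounded sH qH iH uH.
have [k kP] := long_element sH qH iH uH.
(* E, C and C' will bound the overlaps of t and t^-1 with their translates, of the
   beginnings of the letters, and of the letters *)
have [x [C1 xP]] := generic_prefix a (len b) k sH qH iH uH.
have [C2 C2P] := kP x.
pose la := len a; pose E := (C1 + C2)%N.
pose C := (E + 4 * la)%N; pose C' := (C + 2 * D)%N.
have [t [tL xt xtV ttV]] := C2P (4 * C' + 4 * D + 4 * la + len b + K).+1%N.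
(* a letter is indexed by its type, t or y, and by its sign *)
pose g (i : bool) := if i then a else 1.
pose e (s : bool) := if s then t^-1 else t.
pose f (s : bool) := if s then b^-1 else b.
pose letter i s := if i then a * e s * f s * e s * a^-1 else e s.
have eV s : (e s)^-1 = e (~~ s) by case: s; rewrite /= ?invgK.
have fV s : (f s)^-1 = f (~~ s) by case: s; rewrite /= ?invgK.
have letterV i s : (letter i s)^-1 = letter i (~~ s).
  by case: i => //=; rewrite -eV -fV; gsimpl.
have le_ s : len (e s) = len t by case: s; rewrite /= ?lenV.
have lf s : len (f s) = len b by case: s; rewrite /= ?lenV.
have lg i : (len (g i) <= la)%N by case: i; rewrite /= ?len1.
have gin i : g i \in [:: 1; a] by case: i; rewrite !inE eqxx ?orbT.
have xe s : gromov_le k x 1 (e s) by case: s.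
have fN s : ~ bounded_conj (f s).
  by case: s => //= bVN; apply: bN; rewrite -[b]invgK; apply: subgroupV.
have diverge h i i' s s' : H h -> ~ [/\ h = 1, i = i' & s = s'] ->
    gromov_le E 1 (e s') ((g i')^-1 * h * g i * e s).
  move=> Hh ne; pose c := (g i')^-1 * h * g i.
  have [c1|c1] := pselect (c = 1).
    (* a is not in H, so c = 1 forces g i = g i' *)
    have ii' : i = i'.
      case: i i' @c c1 {ne} => [] [] //= c1; exfalso.
        apply: (aHN h) => //; suff -> : a * h = 1 by [].
        by move: c1; rewrite invg1 mul1g => /mulg1_eq <-; gsimpl.
      apply: (aHN h^-1); first exact: subgroupV.
      suff -> : a * h^-1 = 1 by [].
      by move: c1; rewrite mulg1 => /mulg1_eq; rewrite invgK => ->; gsimpl.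
    have h1 : h = 1.
      suff -> : h = g i' * c * (g i)^-1 by rewrite c1 ii'; gsimpl.
      by rewrite /c; gsimpl.
    rewrite -/c c1 mul1g; case: s s' ne => [] [] ne; rewrite /e.
    - by case: ne.
    - by apply: gromov_le_weaken ttV; rewrite /E; lia.
    - by apply: gromov_le_weaken (gromov_le_sym ttV); rewrite /E; lia.
    - by case: ne.
  have cN : ~ bounded_conj c.
    move=> cN; case: i i' @c c1 cN {ne} => [] [] /= c1 cN.
    - apply: c1; suff -> : h = 1 by gsimpl.
      apply: HN => //; suff -> : h = (a^-1 * h * a) ^ a^-1.
        by apply/bounded_conjJ.
      by rewrite conjgE; gsimpl.
    - apply: (aHN h) => //; suff -> : a * h = (1^-1 * h * a) ^ a^-1.
        by apply/bounded_conjJ.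
      by rewrite conjgE; gsimpl.
    - apply: (aHN h^-1); first exact: subgroupV.
      suff -> : a * h^-1 = ((a^-1 * h * 1)^-1) ^ (a^-1).
        by apply/bounded_conjJ; apply: subgroupV.
      by rewrite conjgE; gsimpl.
    - by apply: c1; apply: HN; rewrite ?invg1 ?mul1g ?mulg1 // in cN *.
  have [_ xc] := xP (e s') (e s) (xe s') (xe s).
  apply: (@gromov_le_weaken C1); first by rewrite /E; lia.
  by apply: xc => //; right; exists (g i), (g i'), h.
have Hstart h i s : H h -> gromov_le C 1 h (g i * e s).
  move=> Hh; have [eH _] := xP (e s) (e s) (xe s) (xe s).
  have := eH (g i) h (gin i) Hh; have := lg i; rewrite /C /E.
  have := dT 1 (g i) (g i * e s); have := dT (g i) 1 h; have := dT 1 (g i) h.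
  have := dT (g i) 1 (g i * e s); have := dist_mul (g i) (e s).
  rewrite /gromov_le; have -> : d (e s) ((g i)^-1 * h) = d (g i * e s) h.
    by rewrite -(dL (g i)) mulVKg.
  have -> : d ((g i)^-1 * h) 1 = d h (g i).
    by rewrite -(dL (g i)) mulVKg mulg1.
  dist_lia.
have start_start h i i' s s' : H h -> ~ [/\ h = 1, i = i' & s = s'] ->
    gromov_le C 1 (g i' * e s') (h * (g i * e s)).
  move=> Hh ne; have := diverge h i i' s s' Hh ne; have := lg i'; rewrite /C /E.
  have -> : (g i')^-1 * h * g i * e s = (g i')^-1 * (h * (g i * e s)).
    by rewrite !mulgA.
  move: (h * _) => z; rewrite /gromov_le.
  have -> : d (e s') ((g i')^-1 * z) = d (g i' * e s') z.
    by rewrite -(dL (g i')) mulVKg.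
  have -> : d ((g i')^-1 * z) 1 = d z (g i').
    by rewrite -(dL (g i')) mulVKg mulg1.
  have := dT 1 (g i') (g i' * e s'); have := dT 1 (g i') z.
  have := dist_mul (g i') (e s'); dist_lia.
(* there is little cancellation in y, as b is not in the FC-center *)
have begins i s : gromov_le C (g i * e s) 1 (letter i s).
  case: i => /=; last by rewrite mul1g; dist_lia.
  have xeV : gromov_le k x 1 (e s)^-1 by rewrite eV.
  have [_ xc] := xP _ _ xeV (xe s).
  have := xc (f s) (fN s); rewrite lf leqnn => /(_ (or_introl isT)).
  rewrite /gromov_le.
  have -> : d (e s)^-1 (f s * e s) = len (e s * f s * e s).
    by rewrite distE; gsimpl.
  pose y := a * e s * f s * e s * a^-1; rewrite -/y.
  have := dist_mul (a * e s) (f s * e s * a^-1).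
  have -> : a * e s * (f s * e s * a^-1) = y by rewrite /y; gsimpl.
  have := lenM (f s * e s) a^-1; have := lenM a (e s); have := lenV a.
  have -> : e s * f s * e s = a^-1 * (y * a) by rewrite /y; gsimpl.
  have := lenM a^-1 (y * a); have := lenM y a; have := lenV (e s).
  rewrite /C /E /la; dist_lia.
have letter_long i s : (2 * C' + 3 * D + K + la < len (letter i s))%N.
  have := begins i s; have := lg i; have := lenM (g i)^-1 (g i * e s).
  rewrite mulKg lenV le_ /C' in tL *; dist_lia.
pose Y := [set letter p.1 p.2 | p in [set: bool * bool]].
have Ysym y : Y y -> Y y^-1.
  by move=> [[i s] _ <-]; exists (i, ~~ s); rewrite ?letterV.
have Ylong y : Y y -> (2 * C' + 3 * D < len y)%N.
  by move=> [[i s] _ <-]; have := letter_long i s => /=; lia.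
have Ybounded y : Y y -> (len y <= len (letter true true) + len (letter true false)
    + len (letter false true) + len (letter false false))%N.
  by move=> [[[] []] _ <-] /=; lia.
have start_long i s : (2 * C + C' + 4 * D < len (g i * e s))%N.
  have := lenM (g i)^-1 (g i * e s); rewrite mulKg lenV le_.
  by have := lg i; rewrite /C' in tL *; lia.
have HY h y : H h -> Y y -> gromov_le C' 1 h y.
  move=> Hh [[i s] _ <-] /=; apply: (@gromov_le_weaken (C + D)).
    by rewrite /C'; lia.
  apply: gromov_le_extend (Hstart h i s Hh) (begins i s) _.
  by have := start_long i s; lia.
have YHY h y y' : H h -> Y y -> Y y' -> ~ (h = 1 /\ y = y') ->
    gromov_le C' 1 (h * y) y'.
  move=> Hh [[i s] _ <-] [[i' s'] _ <-] /= ne.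
  have ne' : ~ [/\ h = 1, i = i' & s = s'].
    by move=> [h1 ii' ss']; apply: ne; rewrite ii' ss'.
  apply: (@gromov_le_weaken (C + D + D)); first by rewrite /C'; lia.
  apply: gromov_le_extend (begins i' s') _; last by have := start_long i' s'; lia.
  apply: gromov_le_sym; rewrite -[g i' * e s']invgK.
  apply: (@junction C _ h (g i * e s)).
  - by rewrite invgK; apply/gromov_le_sym/Hstart.
  - by apply: Hstart; apply: subgroupV.
  - by rewrite invgK; apply: start_start.
  - by apply: gromov_le_weaken (begins i s); lia.
  - by have := start_long i s; rewrite /C'; lia.
have long m : word_group H Y m -> ~ H m -> (K + la < len m)%N.
  move=> Jm nHm; have [_ [[i s] _ <-] /=] := word_group_length sH Ysym Ylong HY YHY Jm nHm.
  by have := letter_long i s; lia.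
have letterJ i s : word_group H Y (letter i s).
  by apply: word_group_letter => //; exists (i, s).
exists (word_group H Y), t; split.
- split; [exact: word_group_subgroup| |exact: word_group_base].
  exact: (word_group_quasiconvex sH qH Ysym Ylong Ybounded HY YHY).
- exact: (letterJ false false).
- exact: (letterJ true false).
- move=> c Jc cN; have [Hc|nHc] := pselect (H c); first exact: HN.
  by have := long c Jc nHc; have := KP c cN; lia.
move=> m Jm amN; have [Hm|nHm] := pselect (H m); first exact: aHN amN.
have := long m Jm nHm; have := KP _ amN; have := lenM a^-1 (a * m).
by rewrite mulKg lenV /la; lia.
Qed.

End HyperbolicGeometry.

(** * The word metric *)

Section WordMetric.
Variables (G : groupType) (A : set G).
Hypotheses (A_finite : finite_set A) (A_symmetric : forall a, A a -> A a^-1).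
Hypothesis A_generates : generates A.
Implicit Types (x y z g : G) (s : seq G).

Local Notation edge := (cayley_edge A).
Local Notation epath := (edge_path A).
Local Notation d := (word_dist A).

Lemma edge_sym : symmetric edge.
Proof.
suff edgeV x y : edge x y -> edge y x by move=> x y; apply/idP/idP; apply: edgeV.
by rewrite /cayley_edge !inE => /A_symmetric; rewrite invgM invgK.
Qed.

Lemma edge_path_cat x y z s t : epath x y s -> epath y z t -> epath x z (s ++ t).
Proof.
rewrite /edge_path cat_path last_cat => /andP[-> /eqP->] /andP[-> /eqP->].
by rewrite eqxx.
Qed.

Lemma edge_path_split x y s t : epath x y (s ++ t) ->
  epath x (last x s) s /\ epath (last x s) y t.
Proof.
by rewrite /edge_path cat_path last_cat -andbA => /and3P[-> -> ->]; rewrite eqxx.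
Qed.

Lemma edge_path_mulg g x y s : epath x y s -> epath (g * x) (g * y) (map ( *%g g) s).
Proof.
rewrite /edge_path last_map => /andP[xs /eqP->]; rewrite eqxx andbT.
elim: s x xs {y} => //= z s IH x /andP[xz /IH->]; rewrite andbT.
by move: xz; rewrite /cayley_edge invgM -mulgA mulKg.
Qed.

Lemma edge_path_rev x y s : epath x y s ->
  exists2 t, epath y x t & size t = size s.
Proof.
move=> /andP[xs /eqP<-]; exists (rev (belast x s)).
  rewrite /edge_path rev_path (eq_path (e' := edge)) ?xs //=; last first.
    by move=> u v; rewrite edge_sym.
  by case: s xs => //= z s _; rewrite rev_cons last_rcons.
by rewrite size_rev size_belast.
Qed.

Lemma edge_path_exists x y : exists s, epath x y s.
Proof.
pose S := [set g | exists s, epath 1 g s].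
have sS : subgroup S.
  apply: subgroupP => [|g h [s gs] [t ht]|g [s gs]].
  - by exists [::]; rewrite /edge_path /=.
  - exists (s ++ map ( *%g g) t); apply: (edge_path_cat gs).
    by have := edge_path_mulg g ht; rewrite mulg1.
  - have [t gt _] := edge_path_rev gs; exists (map ( *%g g^-1) t).
    by have := edge_path_mulg g^-1 gt; rewrite mulVg mulg1.
have [s sP] : S (x^-1 * y).
  have : smallest (@subgroup G) A (x^-1 * y) by rewrite A_generates.
  apply; split=> // a Aa; exists [:: a].
  by rewrite /edge_path /= eqxx !andbT /cayley_edge invg1 mul1g inE.
exists (map ( *%g x) s).
by have := edge_path_mulg x sP; rewrite mulVKg mulg1.
Qed.

Lemma word_distP x y :
  (exists2 s, epath x y s & size s = d x y) /\
  forall s, epath x y s -> (d x y <= size s)%N.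
Proof.
apply: (@xgetPex _ 0%N [set n | (exists2 s, epath x y s & size s = n) /\
  forall s, epath x y s -> (n <= size s)%N]).
pose P n := `[<exists2 s, epath x y s & size s = n>].
have exP : exists n, P n.
  by have [s xs] := edge_path_exists x y; exists (size s); apply/asboolP; exists s.
have [n /asboolP nP nmin] := ex_minnP exP.
by exists n; split=> // s xs; apply: nmin; apply/asboolP; exists s.
Qed.

Lemma word_dist_le x y s : epath x y s -> (d x y <= size s)%N.
Proof. exact: (word_distP x y).2. Qed.

Lemma word_dist_refl x : d x x = 0%N.
Proof.
by apply/eqP; rewrite -leqn0 (@word_dist_le x x [::]) // /edge_path /=.
Qed.

Lemma word_dist_sym x y : d x y = d y x.
Proof.
suff le u v : (d u v <= d v u)%N by apply/eqP; rewrite eqn_leq !le.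
have [[s vs <-] _] := word_distP v u; have [t ut <-] := edge_path_rev vs.
exact: word_dist_le.
Qed.

Lemma word_dist_triangle x y z : (d x z <= d x y + d y z)%N.
Proof.
have [[s xs <-] _] := word_distP x y; have [[t yt <-] _] := word_distP y z.
by rewrite -size_cat; apply/word_dist_le/edge_path_cat/yt.
Qed.

Lemma word_dist_mulg g x y : d (g * x) (g * y) = d x y.
Proof.
have le h u v : (d (h * u) (h * v) <= d u v)%N.
  have [[s us <-] _] := word_distP u v.
  by rewrite -(size_map ( *%g h)); apply/word_dist_le/edge_path_mulg.
by apply/eqP; rewrite eqn_leq le -{1}(mulKg g x) -{1}(mulKg g y) le.
Qed.

Lemma word_dist_between x y k : (k <= d x y)%N ->
  exists2 z, d x z = k & d z y = (d x y - k)%N.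
Proof.
move=> kd; have [[s xs sd] _] := word_distP x y.
move: xs; rewrite -(cat_take_drop k s) => /edge_path_split[xz zy].
set z := last x _ in xz zy; exists z;
  have := word_dist_le xz; have := word_dist_le zy;
  have := word_dist_triangle x z y; rewrite size_drop size_takel ?sd //; lia.
Qed.

Lemma word_ball_finite r : exists B : seq G, forall x, (d 1%g x <= r)%N -> x \in B.
Proof.
have /finite_seqP[la laE] := A_finite.
elim: r => [|r [B BP]].
  exists [:: 1] => x; rewrite leqn0 => /eqP x0; rewrite inE.
  have [[s xs s0] _] := word_distP 1 x; rewrite x0 in s0.
  by move: xs; rewrite (size0nil s0) /edge_path /= eq_sym.
exists (B ++ [seq b * a | b <- B, a <- la]) => x xr; rewrite mem_cat.
have [|xr'] := leqP (d 1 x) r; first by move=> /BP->.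
have [z /= z1 zx] := word_dist_between (ltnW xr').
apply/orP; right; apply/allpairsP; exists (z, z^-1 * x); split=> /=.
- by apply: BP; rewrite z1.
- have [[s zs sd] _] := word_distP z x.
  have {zx sd} : size s = 1%N by lia.
  case: s zs => [|y [|? ?]] //; rewrite /edge_path /= andbT => /andP[zy /eqP<-] _.
  by move: zy; rewrite /cayley_edge inE laE.
- by rewrite mulVKg.
Qed.

Lemma word_hyperbolic_metric : hyperbolic A -> exists D, hyperbolic_metric d D.
Proof.
move=> [delta delta0 hyp]; pose D := Num.bound (2 * delta)%R.
have Dbig : (2 * delta <= D%:R)%R.
  by apply/Order.POrderTheory.ltW/Num.Theory.archi_boundP; lra.
exists D; split.
- exact: word_dist_refl.
- exact: word_dist_sym.
- exact: word_dist_triangle.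
- exact: word_dist_mulg.
- move=> x y z w; have := hyp x y z w; rewrite /gromov_product.
  have -> : (d x y + d z w <= maxn (d x z + d y w) (d x w + d y z) + D)%N =
    ((d x y + d z w <= d x z + d y w + D)%N ||
     (d x y + d z w <= d x w + d y z + D)%N) by rewrite addn_maxl leq_max.
  rewrite -!(Num.Theory.ler_nat rat) !GRing.natrD.
  set p := (_ / 2)%R; set q := (_ / 2)%R; set m := (_ / 2)%R.
  by have [pq|pq] := Order.TotalTheory.leP p q => h; apply/orP; [left|right];
    rewrite /p /q /m in h; lra.
- exact: word_dist_between.
- exact: word_ball_finite.
Qed.

Lemma quasiconvex_word_dist Q : quasiconvex A Q <-> quasiconvex_dist d Q.
Proof.
split=> -[eta etaP]; exists eta.
  move=> u v x Qu Qv uxv; have [[s us sd] _] := word_distP u x.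
  have [[t xt td] _] := word_distP x v.
  apply: (etaP u v Qu Qv (s ++ t)).
    by split; [apply: edge_path_cat xt|rewrite size_cat sd td].
  by move: us => /andP[_ /eqP<-]; rewrite -cat_cons mem_cat mem_last.
move=> u v Qu Qv s [us sd] x xs; apply: etaP Qu Qv _ => //.
case/splitPl: xs us sd => s1 s2 <- /edge_path_split[us1 us2].
rewrite size_cat => sd; apply/eqP; rewrite eqn_leq word_dist_triangle andbT -sd.
by rewrite leq_add // word_dist_le.
Qed.

End WordMetric.

(** * The profinite closure *)

Section ProfiniteClosure.
Variable G : groupType.
Implicit Types (g x y a : G) (H K N : set G).

Lemma lcosetE g H x : lcoset g H x <-> H (g^-1 * x).
Proof.
split=> [[h Hh <-]|Hx]; first by rewrite mulKg.
by exists (g^-1 * x); rewrite ?mulVKg.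
Qed.

Lemma lcoset_eq H x y : subgroup H -> lcoset x H = lcoset y H <-> H (x^-1 * y).
Proof.
move=> sH; split=> [xy|xy].
  by apply/lcosetE; rewrite xy; apply/lcosetE; rewrite mulVg; apply: subgroup1.
apply/seteqP; split=> z /lcosetE Hz; apply/lcosetE.
  have -> : y^-1 * z = (x^-1 * y)^-1 * (x^-1 * z).
    by rewrite invgM invgK -mulgA mulVKg.
  by apply: subgroupM => //; apply: subgroupV.
have -> : x^-1 * z = x^-1 * y * (y^-1 * z) by rewrite -mulgA mulVKg.
exact: subgroupM.
Qed.

Lemma finite_index_factor (U : Type) (f : G -> U) K : subgroup K ->
  finite_set (range f) -> (forall x y, f x = f y -> K (x^-1 * y)) ->
  finite_index K.
Proof.
move=> sK finf fK.
have [h hP] : {h : U -> set G & forall x, h (f x) = lcoset x K}.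
  have [h hP] : {h : U -> set G & forall v x, v = f x -> h v = lcoset x K}.
    apply: (@choice _ _ (fun v C => forall x, v = f x -> C = lcoset x K)) => v.
    have [[x vx]|nov] := pselect (exists x, v = f x).
      by exists (lcoset x K) => y vy; apply/lcoset_eq/fK; rewrite -?vx.
    by exists setT => x vx; case: nov; exists x.
  by exists h => x; apply: hP.
apply: (@sub_finite_set _ _ (h @` range f)); last exact: finite_image.
by move=> _ [x _ <-]; exists (f x); [exists x|].
Qed.

Lemma finite_indexI H K : subgroup H -> subgroup K -> finite_index H ->
  finite_index K -> finite_index (H `&` K).
Proof.
move=> sH sK fH fK.
apply: (@finite_index_factor _ (fun x => (lcoset x H, lcoset x K))).
- exact: subgroupI.
- apply: (@sub_finite_set _ _ (range (fun x => lcoset x H) `*`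
    range (fun x => lcoset x K))); last exact: finite_setX.
  by move=> _ [x _ <-]; split; exists x.
- by move=> x y [/lcoset_eq xyH /lcoset_eq xyK]; split; [apply: xyH|apply: xyK].
Qed.

Lemma finite_index_conj_set K g : subgroup K -> finite_index K ->
  finite_index (conj_set K g).
Proof.
move=> sK fK; apply: (@finite_index_factor _ (fun x => lcoset (x * g) K)).
- exact: conj_set_subgroup.
- by apply: sub_finite_set fK => _ [x _ <-]; exists (x * g).
- move=> x y /lcoset_eq -/(_ sK).
  by rewrite /conj_set /= conjgE invgM !mulgA.
Qed.

Lemma normal_finite_indexI H K : normal_finite_index H ->
  normal_finite_index K -> normal_finite_index (H `&` K).
Proof.
move=> [sH nH fH] [sK nK fK]; split.
- exact: subgroupI.
- by move=> g n [? ?]; split; [apply: nH|apply: nK].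
- exact: finite_indexI.
Qed.

Lemma normal_finite_indexT : normal_finite_index [set: G].
Proof.
have sT : subgroup [set: G] by apply: subgroupP.
by split=> //; apply: (@finite_index_factor _ (fun=> tt)).
Qed.

Lemma not_infinite_index H : subgroup H -> ~ infinite_index H ->
  finite_index H.
Proof.
move=> sH niH; apply: contrapT => nfH; apply: niH => l; apply: contrapT => cov.
apply: nfH; apply: (@sub_finite_set _ _ ((fun g => lcoset g H) @` [set` l])).
  move=> _ [x _ <-]; apply: contrapT => nox; apply: cov; exists x => g gl gx.
  by apply: nox; exists g => //; apply/lcoset_eq.
exact/finite_image/finite_seq.
Qed.

Lemma finite_index_not_infinite H : subgroup H -> finite_index H ->
  ~ infinite_index H.
Proof.
move=> sH /finite_seqP[cs csE] iH.
have [rep repP] : {rep : set G -> G & forall C, (exists x, C = lcoset x H) ->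
    C = lcoset (rep C) H}.
  apply: (@choice _ _ (fun C g => (exists x, C = lcoset x H) -> C = lcoset g H)).
  by move=> C; have [[x ?]|?] := pselect (exists x, C = lcoset x H);
    [exists x|exists 1].
have [x xP] := iH (map rep cs); apply: (xP (rep (lcoset x H))).
  apply: map_f; have : range (fun g => lcoset g H) (lcoset x H) by exists x.
  by rewrite csE.
by apply/lcoset_eq => //; rewrite -repP //; exists x.
Qed.

(** The intersection of all conjugates of K; finitely many of them suffice. *)
Lemma core K : subgroup K -> finite_index K ->
  exists2 N, normal_finite_index N & N `<=` K.
Proof.
move=> sK fK.
have [l lP] : exists l : seq G, forall x, exists2 g, g \in l & K (x^-1 * g).
  apply: contrapT => nol; apply: (finite_index_not_infinite sK fK) => l.
  apply: contrapT => nox; apply: nol; exists l => x.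
  apply: contrapT => nog; apply: nox; exists x => g gl gx.
  apply: nog; exists g => //; rewrite -[x^-1 * g]invgK.
  by apply: subgroupV => //; rewrite invgM invgK.
pose N := [set n | forall g, K (n ^ g)].
have NE n : N n <-> forall g, g \in l -> K (n ^ g).
  split=> [nN g _|nl x]; first exact: nN.
  have [g gl xg] := lP x; have := nl g gl.
  have -> : n ^ x = (x^-1 * g) * n ^ g * (x^-1 * g)^-1.
    by rewrite !conjgE invgM invgK !mulgA mulgK mulgK.
  by move=> Kn; apply: subgroupM; [|apply: subgroupM|apply: subgroupV].
have sN : subgroup N.
  apply: subgroupP => [g|x y xN yN g|x xN g].
  - by rewrite conj1g; apply: subgroup1.
  - by rewrite conjMg; apply: subgroupM.
  - by rewrite conjVg; apply: subgroupV.
exists N; last by move=> n /(_ 1); rewrite conjg1.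
split=> //; first by move=> g n nN h; rewrite -conjgM.
pose Nl (s : seq G) := [set n | forall g, g \in s -> K (n ^ g)].
have -> : N = Nl l by apply/seteqP; split=> n /NE.
have : subgroup (Nl l) /\ finite_index (Nl l); last by case.
elim: l {lP NE} => [|g s [sNs fNs]].
  have -> : Nl [::] = setT by rewrite -subTset => n _ g.
  by have [sT _ fT] := normal_finite_indexT.
have -> : Nl (g :: s) = conj_set K g `&` Nl s.
  apply/seteqP; split=> [n nN|n [ng ns] h].
    by split=> [|h hs]; apply: nN; rewrite inE ?eqxx ?hs ?orbT.
  by rewrite inE => /orP[/eqP->|/ns].
have sg := conj_set_subgroup g sK; split; last first.
  by apply: finite_indexI => //; apply: finite_index_conj_set.
exact: subgroupI.
Qed.

Definition profinite_closure H : set G :=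
  [set a | forall N, normal_finite_index N -> exists2 h, H h & N (h^-1 * a)].

Lemma profinite_closedP H : profinite_closure H `<=` H ->
  closed (H : set (profinite G)).
Proof.
move=> clH; rewrite -[H]setCK; apply: (@open_closedC (profinite G)).
exists [set C | profinite_base C /\ C `<=` ~` H]; first by move=> C [].
apply/seteqP; split=> [x [C [_ CH] Cx]|x Hx]; first exact: CH.
have : ~ profinite_closure H x by move=> /clH.
move=> /existsNP[N /not_implyP[nN noh]].
exists (lcoset x N); last first.
  by apply/lcosetE; rewrite mulVg; apply: subgroup1; case: nN.
split; first by exists x, N.
move=> h /lcosetE xh Hh; apply: noh; exists h => //.
rewrite -[h^-1 * x]invgK; apply: subgroupV; first by case: nN.
by rewrite invgM invgK.
Qed.

Lemma profinite_closure_sub H K : subgroup K -> finite_index K -> H `<=` K ->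
  profinite_closure H `<=` K.
Proof.
move=> sK fK HK a aH; have [N nN NK] := core sK fK.
have [h Hh /NK ha] := aH N nN; rewrite -(mulVKg h a).
by apply: subgroupM => //; apply: HK.
Qed.

Lemma sub_profinite_closure H : subgroup H -> H `<=` profinite_closure H.
Proof.
by move=> sH h Hh N [sN _ _]; exists h; rewrite ?mulVg //; apply: subgroup1.
Qed.

Lemma profinite_closureS H K : H `<=` K ->
  profinite_closure H `<=` profinite_closure K.
Proof. by move=> HK a aH N /aH[h /HK Kh ?]; exists h. Qed.

Lemma profinite_closure_subgroup H : subgroup H -> subgroup (profinite_closure H).
Proof.
move=> sH; apply: subgroupP => [|x y xH yH N nN|x xH N nN].
- by apply: sub_profinite_closure => //; apply: subgroup1.
- have [h Hh hx] := xH N nN; have [k Hk ky] := yH N nN; case: nN => sN nN _.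
  exists (h * k); first exact: subgroupM.
  have -> : (h * k)^-1 * (x * y) = (h^-1 * x) ^ k * (k^-1 * y).
    by rewrite conjgE invgM !mulgA mulgK.
  by apply: subgroupM => //; apply: nN.
- have [h Hh hx] := xH N nN; case: nN => sN nN _.
  exists h^-1; first exact: subgroupV.
  have -> : h^-1^-1 * x^-1 = ((h^-1 * x)^-1) ^ h^-1.
    by rewrite conjgE invgM !invgK !mulgA mulgK.
  by apply: nN; apply: subgroupV.
Qed.

Lemma residually_finite_seq (l : seq G) : residually_finite G ->
  exists2 N, normal_finite_index N & forall g, g \in l -> g <> 1 -> ~ N g.
Proof.
move=> rf; elim: l => [|g l [N nN NP]].
  by exists setT => //; apply: normal_finite_indexT.
have [->|/rf[N' nN' N'g]] := pselect (g = 1).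
  by exists N => // h; rewrite inE => /orP[/eqP->|/NP].
exists (N `&` N'); first exact: normal_finite_indexI.
move=> h; rewrite inE => /orP[/eqP-> _ []|/NP hP /hP Nh []] //.
Qed.

Lemma finite_profinite_closure H (B : seq G) : residually_finite G ->
  (forall h, H h -> h \in B) -> profinite_closure H `<=` H.
Proof.
move=> rf HB a aH; apply: contrapT => Ha.
have [N nN NP] := residually_finite_seq [seq h^-1 * a | h <- B] rf.
have [h Hh ha] := aH N nN; apply: (NP (h^-1 * a)) => //.
  exact/map_f/HB.
by move=> /mulg1_eq; rewrite invgK => hE; rewrite -hE in Ha.
Qed.

(** Elements of H that are close enough to a lie in N together with a. *)
Lemma profinite_closureI H N a : normal_finite_index N ->
  profinite_closure H a -> N a -> profinite_closure (H `&` N) a.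
Proof.
move=> nN aH Na N' nN'.
have [h Hh [N'ha Nha]] := aH _ (normal_finite_indexI nN' nN).
exists h => //; split=> //; case: nN => sN _ _.
rewrite -[h]invgK -(mulgK a h^-1) invgM invgK.
by apply: subgroupM => //; apply: subgroupV.
Qed.

End ProfiniteClosure.

(** * Non-closed quasiconvex subgroups *)

Section NonClosed.
Variables (G : groupType) (d : G -> G -> nat) (D : nat).
Hypothesis hm : hyperbolic_metric d D.
Hypothesis G_rf : residually_finite G.
Implicit Types (a b g h x : G) (H J N : set G).

(** H meets only finitely many cosets of N, and multiplying an element of H on the
    right by the inverse of a representative of its coset moves it into N by a
    bounded amount. *)
Lemma quasiconvexI_normal H N : subgroup H -> quasiconvex_dist d H ->
  normal_finite_index N -> quasiconvex_dist d (H `&` N).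
Proof.
move=> sH [eta etaP] [sN nN /finite_seqP[cs csE]].
have [rep repP] : {rep : set G -> G & forall C, (exists2 h, H h & C h) ->
    H (rep C) /\ C (rep C)}.
  apply: (@choice _ _ (fun C g => (exists2 h, H h & C h) -> H g /\ C g)) => C.
  by have [[h Hh Ch]|noh] := pselect (exists2 h, H h & C h);
    [exists h|exists 1].
pose M := (\max_(C <- cs) d 1%g (rep C))%N.
exists (eta + M)%N => u v x [Hu _] [Hv _] uxv.
have [h Hh xh] := etaP u v x Hu Hv uxv.
have hcs : lcoset h N \in cs.
  have : range (fun g => lcoset g N) (lcoset h N) by exists h.
  by rewrite csE.
have [|Hr hr] := repP (lcoset h N).
  by exists h => //; apply/lcosetE; rewrite mulVg; apply: subgroup1.
set r := rep _ in Hr hr; exists (h * r^-1).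
  split; first by apply: subgroupM => //; apply: subgroupV.
  have /lcosetE Nhr := hr.
  have -> : h * r^-1 = ((h^-1 * r)^-1) ^ r^-1.
    by rewrite conjgE invgM !invgK !mulgA mulgV mul1g.
  by apply: nN; apply: subgroupV.
apply: leq_trans (dist_triangle hm x h _) _; apply: leq_add => //.
rewrite (dist_mul hm) (lenV hm).
exact: (@leq_bigmax_seq _ cs xpredT (fun C => d 1 (rep C)) (lcoset h N)).
Qed.

Lemma not_closed_large H a : subgroup H -> profinite_closure H a -> ~ H a ->
  infinite_index H /\ unbounded d H.
Proof.
move=> sH aH Ha; split.
  apply: contrapT => niH; apply: Ha.
  by apply: (profinite_closure_sub sH (not_infinite_index sH niH)) aH.
move=> r; apply: contrapT => bounded; apply: Ha.
have [B BP] := finite_ball hm r.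
apply: (@finite_profinite_closure _ H B) => // h Hh; apply: BP.
by rewrite leqNgt; apply/negP => rh; apply: bounded; exists h.
Qed.

(** The property of H that is preserved when H is enlarged.  The last condition
    says that a is not in H, even modulo the FC-center. *)
Definition separated a H : Prop :=
  [/\ subgroup H, quasiconvex_dist d H, profinite_closure H a,
      forall c, H c -> bounded_conj d c -> c = 1 &
      forall h, H h -> ~ bounded_conj d (a * h)].

Lemma separated_notin a H : separated a H -> ~ H a.
Proof.
move=> [sH _ _ _ aHN] Ha; apply: (aHN a^-1); first exact: subgroupV.
by rewrite mulgV; apply: subgroup1 (bounded_conj_subgroup hm).
Qed.

Lemma separated_large a H : separated a H -> infinite_index H /\ unbounded d H.
Proof.
by move=> /[dup] /separated_notin Ha [sH _ aH _ _]; apply: not_closed_large aH Ha.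
Qed.

(** Since t and y = a t b t a^-1 belong to the new subgroup J and a belongs to
    its closure, so does b. *)
Lemma separated_extend a b H : separated a H -> ~ bounded_conj d b ->
  exists J, [/\ separated a J, H `<=` J & profinite_closure J b].
Proof.
move=> sepH bN; have [iH uH] := separated_large sepH.
have [sH qH aH HN aHN] := sepH.
have [J [t [[sJ qJ HJ] Jt Jy JN aJN]]] :=
  extend_subgroup hm sH qH iH uH HN aHN bN.
have aJ := profinite_closureS HJ aH.
exists J; split=> //.
have sC := profinite_closure_subgroup sJ.
have tC := sub_profinite_closure sJ Jt; have yC := sub_profinite_closure sJ Jy.
have -> : b = t^-1 * a^-1 * (a * t * b * t * a^-1) * a * t^-1.
  by rewrite !mulgA !mulgVK !mulgK mulVg mul1g.
by do 4 ?apply: (subgroupM sC) => //; apply: (subgroupV sC).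
Qed.

(** If b lies in the FC-center, it is a product of elements outside of it. *)
Lemma separated_extend_all a H : separated a H -> forall b : G,
  exists J, [/\ separated a J, H `<=` J & profinite_closure J b].
Proof.
move=> sepH b; have [bN|] := pselect (bounded_conj d b); last first.
  exact: separated_extend.
have [iH uH] := separated_large sepH; have [sH qH _ _ _] := sepH.
have sN := bounded_conj_subgroup hm.
have [K KP] := bounded_conj_bounded hm sH qH iH uH.
have [s _ sbig] := uH K.
have nNs : ~ bounded_conj d s by move=> /KP; rewrite leqNgt sbig.
have [J1 [sep1 HJ1 J1s]] := separated_extend sepH nNs.
have [|J2 [sep2 J12 J2bs]] := @separated_extend a (b * s) J1 sep1.
  move=> bsN; apply: nNs; rewrite -(mulKg b s).
  by apply: subgroupM => //; apply: subgroupV.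
exists J2; split=> // [h /HJ1/J12//|]; rewrite -(mulgK s b).
have [sJ2 _ _ _ _] := sep2; have sC := profinite_closure_subgroup sJ2.
apply: (subgroupM sC) => //; apply: (subgroupV sC).
exact: profinite_closureS J1s.
Qed.

Lemma separated_dense a H (l : seq G) : separated a H ->
  exists2 J, separated a J & forall b, b \in l -> profinite_closure J b.
Proof.
move=> sepH; elim: l => [|b l [J sepJ Jl]]; first by exists H.
have [J' [sepJ' JJ' J'b]] := separated_extend_all sepJ b.
exists J' => // c; rewrite inE => /orP[/eqP->//|/Jl].
exact: profinite_closureS.
Qed.

(** As the FC-center is finite, some finite index normal subgroup meets it
    trivially; pass to the intersections with it. *)
Lemma not_closed_separated H a : subgroup H -> quasiconvex_dist d H ->
  profinite_closure H a -> ~ H a -> exists a' H', separated a' H'.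
Proof.
move=> sH qH aH Ha; have [iH uH] := not_closed_large sH aH Ha.
have [K KP] := bounded_conj_bounded hm sH qH iH uH.
have [B BP] := finite_ball hm K.
have [N nN NB] := residually_finite_seq B G_rf; have [sN _ _] := nN.
have NFC c : N c -> bounded_conj d c -> c = 1.
  by move=> Nc /KP/BP cB; apply: contrapT => c1; apply: (NB c).
have [h Hh ha] := aH N nN; exists (h^-1 * a), (H `&` N); split.
- exact: subgroupI.
- exact: quasiconvexI_normal.
- apply: profinite_closureI => //.
  apply: (subgroupM (profinite_closure_subgroup sH)) => //.
  by apply: sub_profinite_closure => //; apply: subgroupV.
- by move=> c [_ Nc]; apply: NFC.
move=> k [Hk Nk] /(NFC _ (subgroupM sN ha Nk)) => hak; apply: Ha.
have -> : a = h * (h^-1 * a * k) * k^-1 by rewrite !mulgA mulgK mulgV mul1g.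
by rewrite hak mulg1; apply: subgroupM => //; apply: subgroupV.
Qed.

End NonClosed.

Theorem theorem3 (G : groupType) (A : set G)
  (A_finite : finite_set A)
  (A_symmetric : forall a : G, A a -> A a^-1)
  (A_generates : generates A)
  (G_hyperbolic : hyperbolic A)
  (G_residually_finite : residually_finite G)
  (G_engulfs : forall H : set G, subgroup H -> H <> setT -> quasiconvex A H ->
     engulfed H) :
  GFERF A.
Proof.
have [D hm] := word_hyperbolic_metric A_finite A_symmetric A_generates G_hyperbolic.
move=> H sH /(quasiconvex_word_dist A_symmetric A_generates) qH.
apply: profinite_closedP => a aH; apply: contrapT => Ha.
have [a' [H' sepH']] := not_closed_separated hm G_residually_finite sH qH aH Ha.
have /finite_seqP[la laE] := A_finite.
have [J sepJ Jl] := separated_dense hm G_residually_finite la sepH'.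
have [sJ qJ _ _ _] := sepJ.
have Jdense g : profinite_closure J g.
  have : smallest (@subgroup G) A g by rewrite A_generates.
  apply; split; first exact: profinite_closure_subgroup.
  by rewrite laE => b; apply: Jl.
have [||K [sK fK KT JK]] := G_engulfs J sJ.
- by move=> JT; apply: (separated_notin hm sepJ); rewrite JT.
- exact/quasiconvex_word_dist.
apply: KT; rewrite -subTset => g _.
exact: (profinite_closure_sub sK fK JK).
Qed.
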